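(* Let $\mathbb{X}$ and $\mathbb{Y}$ be Hilbert spaces, $\Omega\subseteq\mathbb{X}$ an open set and $F:\Omega\to\mathbb{Y}$ a continuously differentiable function such that $F'(x)$ has closed image for every $x\in\Omega$. Let $x_*\in\Omega$, $R>0$, $\beta:=\|F'(x_* )^{\dagger}\|$ and $\kappa:=\sup\{t\in[0,R): B(x_*,t)\subset\Omega\}$. Suppose that $F(x_* )=0$, that $F'(x_* )$ is injective, and that there exists a continuously differentiable function $f:[0,R)\to\mathbb{R}$ such that $$\beta\|F'(x)-F'(x_*+\tau(x-x_* ))\|\le f'(\|x-x_*\|)-f'(\tau\|x-x_*\|)$$ for all $\tau\in[0,1]$ and $x\in B(x_*,\kappa)$, and such that (h1) $f(0)=0$ and $f'(0)=-1$; (h2) $f'$ is strictly increasing. Take $0\le\vartheta<1$ and $0\le\omega_2<\omega_1$ such that $\omega_1\vartheta+\omega_2<1$. Let $\nu:=\sup\{t\in[0,R): f'(t)<0\}$, $$\rho:=\sup\left\{\delta\in(0,\nu): \frac{(1+\vartheta)\omega_1[f(t)/f'(t)-t]}{t}+\omega_1\vartheta+\omega_2<1 \text{ for all } t\in(0,\delta)\right\},\qquad r:=\min\{\kappa,\rho\}.$$ Consider the inexact Gauss-Newton like method with initial point $x_0\in B(x_*,r)\setminus\{x_*\}$ defined by $$x_{k+1}=x_k+S_k,\qquad B(x_k)S_k=-F'(x_k)^*F(x_k)+r_k,\qquad k=0,1,\ldots,$$ where $B(x_k)$ is an invertible approximation of $F'(x_k)^*F'(x_k)$ satisfying $$\|B(x_k)^{-1}F'(x_k)^*F'(x_k)\|\le\omega_1,\qquad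 \|B(x_k)^{-1}F'(x_k)^*F'(x_k)-I\|\le\omega_2,\qquad k=0,1,\ldots,$$ and the residual $r_k\in\mathbb{X}$, the forcing term $\theta_k$ and the invertible preconditioner $P_k$ are such that $$\|P_kr_k\|\le\theta_k\|P_kF'(x_k)^*F(x_k)\|,\qquad 0\le\theta_k\,\mathrm{cond}(P_kF'(x_k)^*F'(x_k))\le\vartheta,\qquad k=0,1,\ldots.$$ Define the scalar sequence $\{t_k\}$ by $t_0=\|x_0-x_*\|$ and $$t_{k+1}=(1+\vartheta)\omega_1|t_k-f(t_k)/f'(t_k)|+(\omega_1\vartheta+\omega_2)t_k,\qquad k=0,1,\ldots.$$ Then the sequences $\{x_k\}$ and $\{t_k\}$ are well defined; $\{t_k\}$ is strictly decreasing, contained in $(0,r)$ and converges to $0$. Furthermore, $\{x_k\}$ is contained in $B(x_*,r)$, converges to $x_*$, and $$\limsup_{k\to\infty}\frac{\|x_{k+1}-x_*\|}{\|x_k-x_*\|}\le\omega_1\vartheta+\omega_2,\qquad \lim_{k\to\infty}\frac{t_{k+1}}{t_k}=\omega_1\vartheta+\omega_2.$$ If, additionally, for a given $0\le p\le1$, (h3) the function $(0,\nu)\ni t\mapsto [f(t)/f'(t)-t]/t^{p+1}$ is strictly increasing, then $$\|x_{k+1}-x_*\|\le(1+\vartheta)\omega_1\left(\frac{f(t_0)-t_0f'(t_0)}{t_0^{p+1}f'(t_0)}\right)\|x_k-x_*\|^{p+1}+(\omega_1\vartheta+\omega_2)\|x_k-x_*\|,\qquad k=0,1,\ldots,$$ and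 $\|x_k-x_*\|\le t_k$ for all $k=0,1,\ldots$.
   Context: Hilbert spaces are real or complex. $B(a,\delta)=\{x\in\mathbb{X}:\|x-a\|<\delta\}$ is the open ball. $A^*$ denotes the adjoint of a continuous linear operator $A$. For a continuous injective linear operator $A:\mathbb{X}\to\mathbb{Y}$ with closed image, $A^{\dagger}:=(A^*A)^{-1}A^*$ is its Moore-Penrose inverse. For an invertible continuous linear operator $A$, $\mathrm{cond}(A):=\|A^{-1}\|\|A\|$. The operators $B(x_k)$ and $P_k$ are invertible continuous linear operators $\mathbb{X}\to\mathbb{X}$ (''approximation'' has no meaning beyond the stated inequalities); $I$ is the identity of $\mathbb{X}$; the $\theta_k$ are real numbers. Well-definedness of $\{x_k\}$ includes that each $F'(x_k)^*F'(x_k)$ is invertible and each iterate stays in $\Omega$. *)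

(* Defs.v *)
From HB Require Import structures.
From mathcomp Require Import all_boot all_order all_algebra.
From mathcomp Require Import complex.
From mathcomp Require Import all_classical all_reals all_analysis.

Set Implicit Arguments.
Unset Strict Implicit.
Unset Printing Implicit Defensive.

Import Order.TTheory GRing.Theory Num.Theory.
Import numFieldNormedType.Exports.

Local Open Scope classical_set_scope.
Local Open Scope ring_scope.

(* The scalar field of a Hilbert space is either R itself or R[i]. *)
Variant scalars := RealScalars | ComplexScalars.

Definition scal (R : realType) (s : scalars) : numFieldType :=
  match s with
  | RealScalars => R
  | ComplexScalars => R[i]
  end.

Definition scal_conj (R : realType) (s : scalars) : scal R s -> scal R s :=
  match s with
  | RealScalars => fun a => a
  | ComplexScalars => fun a => conjc a
  end.

Fact scal_conj_is_zmod_morphism (R : realType) (s : scalars) :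
  zmod_morphism (@scal_conj R s).
Proof. by case: s => //= a b; rewrite rmorphB. Qed.

Fact scal_conj_is_monoid_morphism (R : realType) (s : scalars) :
  monoid_morphism (@scal_conj R s).
Proof.
case: s => /=; first by [].
by split => [|a b]; [exact: rmorph1 | exact: rmorphM].
Qed.

HB.instance Definition _ (R : realType) (s : scalars) :=
  GRing.isZmodMorphism.Build (scal R s) (scal R s) (@scal_conj R s)
    (@scal_conj_is_zmod_morphism R s).
HB.instance Definition _ (R : realType) (s : scalars) :=
  GRing.isMonoidMorphism.Build (scal R s) (scal R s) (@scal_conj R s)
    (@scal_conj_is_monoid_morphism R s).

Definition scal_re (R : realType) (s : scalars) : scal R s -> R :=
  match s with
  | RealScalars => fun a => a
  | ComplexScalars => fun a => complex.Re a
  end.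

Definition of_real (R : realType) (s : scalars) : R -> scal R s :=
  match s with
  | RealScalars => fun a => a
  | ComplexScalars => fun a => real_complex R a
  end.

(* A complete normed module whose norm comes from a positive definite Hermitian
   form (linear in its first argument, conjugate-linear in the second). *)
Record hilbert (R : realType) (s : scalars) := Hilbert {
  hilbert_sort :> completeNormedModType (scal R s);
  dot : {dot hilbert_sort for @scal_conj R s};
  dot_norm : forall x : hilbert_sort, dot x x = `|x| ^+ 2 }.

Section Operators.
Context {R : realType} {s : scalars}.
Implicit Types X Y : hilbert R s.

(* The library norm takes its values in the scalar field (in R[i] when the
   scalars are complex); this is the same norm as an element of R. *)
Definition hnorm X (x : X) : R := scal_re `|x|.

Definition hball X (a : X) (d : R) : set X := [set x | hnorm (x - a) < d].

(* The supremum is taken in R, hence meaningful only for bounded operators. *)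
Definition opnorm X Y (A : X -> Y) : R :=
  sup [set hnorm (A x) | x in [set x : X | hnorm x <= 1]].

(* adjoint A y is the (unique) vector that represents x |-> dot (A x) y; it
   exists when A is linear and continuous. *)
Definition adjoint X Y (A : X -> Y) (y : Y) : X :=
  get [set z : X | forall x : X, dot Y (A x) y = dot X x z].

Definition invertible_op X Y (A : X -> Y) : Prop :=
  [/\ linear A, continuous A
    & exists A' : Y -> X, [/\ continuous A', cancel A A' & cancel A' A]].

(* The inverse function of A when A is bijective. *)
Definition opinv X Y (A : X -> Y) : Y -> X := 'pinv_(fun=> 0) setT A.

Definition gram X Y (A : X -> Y) : X -> X := adjoint A \o A.

Definition moore_penrose X Y (A : X -> Y) : Y -> X :=
  opinv (gram A) \o adjoint A.

Definition cond X Y (A : X -> Y) : R := opnorm (opinv A) * opnorm A.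

(* F is only relevant on Om; the derivative is continuous on Om for the
   operator norm. *)
Definition C1_on X Y (Om : set X) (F : X -> Y) : Prop :=
  forall x, Om x ->
    differentiable F x /\
    opnorm ('d F y \- 'd F x) @[y --> x] --> (0 : R).

(* The requirements for a Gauss-Newton step to make sense at x. *)
Definition gn_defined X Y (Om : set X) (F : X -> Y) (x : X) : Prop :=
  Om x /\ invertible_op (gram ('d F x)).

End Operators.

(* f is continuously differentiable on [0, b[ with derivative f', one-sided
   at 0. *)
Definition C1_halfopen (R : realType) (b : R) (f f' : R -> R) : Prop :=
  (forall t, t \in `[0, b[ ->
     (f u - f t) / (u - t) @[u --> within (`[0, b[%classic `\ t) (nbhs t)] --> f' t) /\
  {within `[0, b[%classic, continuous f'}.

(* Main.v *)
Require Import Defs.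
From HB Require Import structures.
From mathcomp Require Import all_boot all_order all_algebra.
From mathcomp Require Import complex ring lra.
From mathcomp Require Import all_classical all_reals all_analysis.

Set Implicit Arguments.
Unset Strict Implicit.
Unset Printing Implicit Defensive.

Import Order.TTheory GRing.Theory Num.Theory.
Import numFieldNormedType.Exports.

Local Open Scope classical_set_scope.
Local Open Scope ring_scope.

(* Write e_k = x_k - xs and n(t) = f(t)/f'(t) - t.  The majorant condition gives
   beta |F'(x) - F'(xs)| <= f'(|e|) + 1, so F'(x) is bounded below by -f'(|e|)/beta;
   integrated along the segment from xs to x, it bounds the linearisation error of F
   by (|e| f'(|e|) - f(|e|)) / beta.  Hence an exact Gauss-Newton step leaves an error
   of at most n(|e|), and an inexact one an error of at most
   phi(|e|) = (1 + vth) w1 n(|e|) + (w1 vth + w2) |e|.  Since phi(t) < t on (0, rho)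
   and n(t) = o(t), both |e_k| and t_k decrease to 0 at the claimed rate.
   Only the real norm and the real part of the inner product are needed, so real and
   complex scalars are treated alike.  That F'(xs) is bounded below follows from the
   uniform boundedness principle: the set of w in the range of A = F'(xs) with
   |A^* w| <= 1 is weakly bounded, hence bounded. *)

(** * Real and complex scalars under one interface *)

Section Scalars.
Context {R : realType} {s : scalars}.
Implicit Types (a b : scal R s) (c d : R).

Lemma of_realK c : scal_re (of_real s c) = c.
Proof. by case: s. Qed.

Lemma scal_reD a b : scal_re (a + b) = scal_re a + scal_re b.
Proof. by case: s a b => //= -[? ?] [? ?]. Qed.

Lemma scal_reN a : scal_re (- a) = - scal_re a.
Proof. by case: s a => //= -[? ?]. Qed.

Lemma scal_re_of_realM c a : scal_re (of_real s c * a) = c * scal_re a.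
Proof. by case: s a => //= -[? ?] /=; rewrite mul0r subr0. Qed.

Lemma scal_re_conj a : scal_re (scal_conj a) = scal_re a.
Proof. by case: s a => //= -[? ?]. Qed.

(** The real part in question is the squared modulus of [a]. This is what later recovers an identity
    of full inner products from one of real parts. *)
Lemma scal_re_conjM_eq0 a : scal_re (scal_conj a * a) = 0 -> a = 0.
Proof.
case: s a => /= [a /eqP|[u v] /= /eqP]; first by rewrite mulf_eq0 orbb => /eqP.
rewrite mulNr opprK -!expr2 paddr_eq0 ?sqr_ge0 // !sqrf_eq0.
by move=> /andP[/eqP-> /eqP->].
Qed.

Lemma of_realD c d : of_real s (c + d) = of_real s c + of_real s d.
Proof. by case: s => //=; rewrite rmorphD. Qed.

Lemma of_realN c : of_real s (- c) = - of_real s c.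
Proof. by case: s => //=; rewrite rmorphN. Qed.

Lemma of_realM c d : of_real s (c * d) = of_real s c * of_real s d.
Proof. by case: s => //=; rewrite rmorphM. Qed.

Lemma of_real0 : of_real s 0 = 0 :> scal R s.
Proof. by case: s => //=; rewrite rmorph0. Qed.

Lemma of_real1 : of_real s 1 = 1 :> scal R s.
Proof. by case: s => //=; rewrite rmorph1. Qed.

Lemma of_real_le c d : (of_real s c <= of_real s d) = (c <= d).
Proof. by case: s => //=; rewrite lecR. Qed.

Lemma of_real_lt c d : (of_real s c < of_real s d) = (c < d).
Proof. by case: s => //=; rewrite ltcR. Qed.

Lemma of_real_norm c : `|of_real s c| = of_real s `|c|.
Proof. by case: s => //=; rewrite normc_def /= expr0n /= addr0 sqrtr_sqr. Qed.

(** In the order of [R[i]], [0 <= a] forces the imaginary part of [a] to vanish. Applied to norms,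
    this lets [hnorm] stand for the norm without loss. *)
Lemma scal_re_ge0K a : 0 <= a -> of_real s (scal_re a) = a.
Proof. by case: s a => //= -[u v]; rewrite lecE /= => /andP[/eqP->]. Qed.

End Scalars.

(** * The underlying real inner product space of a Hilbert space *)

Section HilbertReal.
Context {R : realType} {s : scalars} {X : hilbert R s}.
Implicit Types (x y z : X) (c : R).

Definition rscale c x : X := of_real s c *: x.
Definition rdot x y : R := scal_re (dot X x y).

Lemma hnormE x : `|x| = of_real s (hnorm x).
Proof. by rewrite scal_re_ge0K. Qed.

Lemma hnorm_ge0 x : 0 <= hnorm x.
Proof. by rewrite -(of_real_le (s := s)) -hnormE of_real0. Qed.

Lemma hnormD x y : hnorm (x + y) <= hnorm x + hnorm y.
Proof. by rewrite -(of_real_le (s := s)) of_realD -!hnormE ler_normD. Qed.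

Lemma hnorm_opp x : hnorm (- x) = hnorm x.
Proof. by rewrite /hnorm normrN. Qed.

Lemma hnorm0 : hnorm (0 : X) = 0.
Proof. by rewrite /hnorm normr0 -(of_real0 (R := R) (s := s)) of_realK. Qed.

Lemma hnorm_eq0 x : hnorm x = 0 -> x = 0.
Proof. by move=> x0; apply: normr0_eq0; rewrite hnormE x0 of_real0. Qed.

Lemma hnorm_gt0 x : x <> 0 -> 0 < hnorm x.
Proof. by move=> x0; rewrite lt_neqAle hnorm_ge0 andbT eq_sym; apply/eqP => /hnorm_eq0. Qed.

Lemma hnorm_rscale c x : hnorm (rscale c x) = `|c| * hnorm x.
Proof. by rewrite /hnorm normrZ of_real_norm scal_re_of_realM. Qed.

Lemma hdistC x y : hnorm (x - y) = hnorm (y - x).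
Proof. by rewrite -hnorm_opp opprB. Qed.

Lemma hnorm_tri x y z : hnorm (x - z) <= hnorm (x - y) + hnorm (y - z).
Proof. by apply: le_trans (hnormD _ _); rewrite addrA subrK. Qed.

Lemma rdotxx x : rdot x x = hnorm x ^+ 2.
Proof. by rewrite /rdot dot_norm hnormE expr2 -of_realM of_realK expr2. Qed.

Lemma rdotC x y : rdot x y = rdot y x.
Proof.
rewrite /rdot hermitian_subproof /=.
by rewrite expr0 mul1r scal_re_conj.
Qed.

Lemma rdotDl x y z : rdot (x + y) z = rdot x z + rdot y z.
Proof. by rewrite /rdot linearDl scal_reD. Qed.

Lemma rdotZl c x y : rdot (rscale c x) y = c * rdot x y.
Proof. by rewrite /rdot linearZl_LR /= scal_re_of_realM. Qed.

End HilbertReal.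

(** * Convergence and completeness in the real norm *)

Section HilbertTopology.
Context {R : realType} {s : scalars} {X : hilbert R s}.
Implicit Types (x y : X).

Lemma scal_gt0_real (e : scal R s) : 0 < e -> exists2 c : R, 0 < c & e = of_real s c.
Proof.
move=> e0; have eE := scal_re_ge0K (ltW e0); exists (scal_re e) => //.
by rewrite -(of_real_lt (s := s)) eE of_real0.
Qed.

Lemma hcvgP (u : nat -> X) (l : X) :
  u n @[n --> \oo] --> l <-> hnorm (u n - l) @[n --> \oo] --> (0 : R).
Proof.
split=> [/cvgrPdist_lt ul|/cvgr0Pnorm_lt ul].
  apply/cvgr0Pnorm_lt => e e0.
  have e0' : 0 < of_real s e by rewrite -(of_real0 (R := R) (s := s)) of_real_lt.
  near=> n; rewrite ger0_norm ?hnorm_ge0 // -(of_real_lt (s := s)) -hnormE distrC.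
  by near: n; exact: ul.
apply/cvgrPdist_lt => _ /scal_gt0_real[e e0 ->].
near=> n; rewrite distrC hnormE of_real_lt -[ltLHS]ger0_norm ?hnorm_ge0 //.
by near: n; exact: ul.
Unshelve. all: by end_near. Qed.

Lemma hcauchy_cvg (u : nat -> X) :
  (forall e : R, 0 < e -> exists N, forall m n, (N <= m)%N -> (N <= n)%N ->
     hnorm (u m - u n) < e) ->
  exists l, hnorm (u n - l) @[n --> \oo] --> (0 : R).
Proof.
move=> uC; suff /cvg_ex[l /hcvgP ul] : cvgn u by exists l.
apply/cauchy_cvgP/cauchy_ballP => _ /scal_gt0_real[e e0 ->].
have [N uN] := uC e e0.
pose U := [set u n | n in [set n | (N <= n)%N]].
exists (U, U); first by split; exists N => // n Nn; exists n.
move=> [_ _] [/= [m mN <-] [n nN <-]]; rewrite -ball_normE /= hnormE of_real_lt.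
exact: uN.
Qed.

Lemma closed_hcvg (V : set X) (u : nat -> X) (l : X) : closed V ->
  (forall n, V (u n)) -> hnorm (u n - l) @[n --> \oo] --> (0 : R) -> V l.
Proof.
move=> Vc Vu /hcvgP ul; apply: (@closed_cvg _ _ _ eventually_filter u V) ul => //.
exact: nearW.
Qed.

End HilbertTopology.

(** * Continuity and differentiability with real constants *)

Section BoundedOperators.
Context {R : realType} {s : scalars} {X Y : hilbert R s}.

Definition hbounded (A : X -> Y) :=
  exists2 M : R, 0 <= M & forall x, hnorm (A x) <= M * hnorm x.

Definition linear_pack (A : X -> Y) (lA : linear A) : {linear X -> Y} :=
  HB.pack A (GRing.isLinear.Build _ _ _ _ A lA).

Lemma continuous_hbounded (A : X -> Y) : linear A -> continuous A -> hbounded A.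
Proof.
move=> lA cA; have /linear_boundedP : bounded_near (linear_pack lA) (nbhs (0 : X)).
  by apply: continuous_linear_bounded; exact: cA.
move=> /pinfty_ex_gt0[_ /scal_gt0_real[M M0 ->] AM]; exists M; first exact: ltW.
by move=> x; have := AM x; rewrite !hnormE -of_realM of_real_le.
Qed.

Lemma hbounded_continuous (A : X -> Y) : linear A -> hbounded A -> continuous A.
Proof.
move=> lA [M M0 AM]; apply: (@bounded_linear_continuous _ _ _ (linear_pack lA)).
apply/linear_boundedP; near=> c => x.
rewrite (@le_trans _ _ (of_real s M * `|x|)) //.
  by rewrite !hnormE -of_realM of_real_le AM.
apply: ler_wpM2r => //; near: c; apply: nbhs_pinfty_ge.
by apply: ger0_real; rewrite -(of_real0 (R := R) (s := s)) of_real_le.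
Unshelve. all: by end_near. Qed.

Lemma differentiable_hnorm (F : X -> Y) (x : X) : differentiable F x ->
  forall e : R, 0 < e -> exists2 d : R, 0 < d & forall h : X, hnorm h < d ->
    hnorm (F (x + h) - F x - 'd F x h) <= e * hnorm h.
Proof.
move=> /diff_locallyP[_ /eqaddoP dF] e e0.
have e0' : 0 < of_real s e by rewrite -(of_real0 (R := R) (s := s)) of_real_lt.
have /nbhs_norm0P[_ /= /scal_gt0_real[d d0 ->] dH] := dF _ e0'.
exists d => // h hd; have := dH h; rewrite /= !hnormE of_real_lt => /(_ hd).
by rewrite /cst !fctE /= -of_realM of_real_le (addrC h) opprD addrA.
Qed.

End BoundedOperators.

(** * Cauchy-Schwarz and Riesz representation on closed real subspaces *)

Section RealInnerProduct.
Context {R : realType} {s : scalars} {X : hilbert R s}.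
Implicit Types (x y z v : X) (c : R) (V : set X).

Lemma rdotDr x y z : rdot x (y + z) = rdot x y + rdot x z.
Proof. by rewrite ![rdot x _]rdotC rdotDl. Qed.

Lemma rdotZr c x y : rdot x (rscale c y) = c * rdot x y.
Proof. by rewrite ![rdot x _]rdotC rdotZl. Qed.

Lemma rscaleN1 x : rscale (-1) x = - x.
Proof. by rewrite /rscale of_realN of_real1 scaleN1r. Qed.

Lemma rscale0 x : rscale 0 x = 0.
Proof. by rewrite /rscale of_real0 scale0r. Qed.

Lemma rscale1 x : rscale 1 x = x.
Proof. by rewrite /rscale of_real1 scale1r. Qed.

Lemma rscaleDl c d x : rscale (c + d) x = rscale c x + rscale d x.
Proof. by rewrite /rscale of_realD scalerDl. Qed.

Lemma rdotNl x y : rdot (- x) y = - rdot x y.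
Proof. by rewrite -rscaleN1 rdotZl mulN1r. Qed.

Lemma rdotNr x y : rdot x (- y) = - rdot x y.
Proof. by rewrite -rscaleN1 rdotZr mulN1r. Qed.

Lemma rdot0l x : rdot 0 x = 0.
Proof. by rewrite -(rscale0 0) rdotZl mul0r. Qed.

Lemma hnorm_sqrD x y : hnorm (x + y) ^+ 2 = hnorm x ^+ 2 + 2 * rdot x y + hnorm y ^+ 2.
Proof.
rewrite -!rdotxx !rdotDl !rdotDr (rdotC y x); ring.
Qed.

Lemma hnorm_sqrB x y : hnorm (x - y) ^+ 2 = hnorm x ^+ 2 - 2 * rdot x y + hnorm y ^+ 2.
Proof. by rewrite hnorm_sqrD rdotNr hnorm_opp mulrN. Qed.

(** Cauchy-Schwarz: the squared norm of [|y|^2 x - <x, y> y] equals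
    [|y|^2 ((|x| |y|)^2 - <x, y>^2)]. *)
Lemma rdot_le x y : `|rdot x y| <= hnorm x * hnorm y.
Proof.
have [->|/eqP/hnorm_gt0 y0] := eqVneq y 0.
  by rewrite rdotC rdot0l normr0 mulr_ge0 // hnorm_ge0.
have := sqr_ge0 (hnorm (rscale (hnorm y ^+ 2) x - rscale (rdot x y) y)).
rewrite hnorm_sqrB !hnorm_rscale rdotZl rdotZr !exprMn !real_normK ?num_real //.
have -> : hnorm y ^+ 2 ^+ 2 * hnorm x ^+ 2 - 2 * (hnorm y ^+ 2 * (rdot x y * rdot x y)) +
    rdot x y ^+ 2 * hnorm y ^+ 2 =
    hnorm y ^+ 2 * ((hnorm x * hnorm y) ^+ 2 - rdot x y ^+ 2) by ring.
rewrite pmulr_rge0 ?exprn_gt0 // subr_ge0 => h.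
rewrite -(ler_pXn2r (n := 2)) ?nnegrE ?mulr_ge0 ?hnorm_ge0 //.
by rewrite real_normK ?num_real.
Qed.

Lemma rdot_cvg (u : nat -> X) z v : hnorm (u n - z) @[n --> \oo] --> (0 : R) ->
  rdot (u n) v @[n --> \oo] --> rdot z v.
Proof.
move=> uz; apply/subr_cvg0/norm_cvg0P.
apply: (@squeeze_cvgr _ _ _ _ (fun=> 0) (fun n => hnorm (u n - z) * hnorm v)).
- apply: nearW => n; rewrite normr_ge0 /=.
  by apply: le_trans (rdot_le _ _); rewrite rdotDl rdotNl.
- exact: cvg_cst.
- by rewrite -[X in _ --> X](mul0r (hnorm v)); apply: cvgMl.
Qed.

Lemma rdot_eq x y : (forall v, rdot v x = rdot v y) -> x = y.
Proof.
move=> xy; apply/subr0_eq/hnorm_eq0/eqP; rewrite -sqrf_eq0 -rdotxx.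
by rewrite rdotDr rdotNr xy subrr.
Qed.

Definition rsubspace V :=
  [/\ V 0, forall x y, V x -> V y -> V (x + y) & forall c x, V x -> V (rscale c x)].

(** First-order condition at a minimum, tested at the single value [c = - q / (N + 1)]; the shift by
    1 covers [N = 0]. *)
Lemma linear_coef_eq0 (q N : R) : 0 <= N ->
  (forall c, 0 <= 2 * c * q + c ^+ 2 * N) -> q = 0.
Proof.
move=> N0 /(_ (- q / (N + 1))).
have N1 : 0 < N + 1 by lra.
have -> : 2 * (- q / (N + 1)) * q + (- q / (N + 1)) ^+ 2 * N =
  - ((N + 2) * (q / (N + 1)) ^+ 2) by field; lra.
rewrite oppr_ge0 pmulr_rle0; last by lra.
move=> h; have /eqP : (q / (N + 1)) ^+ 2 = 0 by apply/le_anti; rewrite h sqr_ge0.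
by rewrite sqrf_eq0 mulf_eq0 invr_eq0 (gt_eqF N1) orbF => /eqP.
Qed.

(* The functional x |-> |x|^2 - 2 phi x attains its infimum on V. *)
Lemma riesz_subspace V (phi : X -> R) (M : R) : closed V -> rsubspace V ->
  (forall x y, V x -> V y -> phi (x + y) = phi x + phi y) ->
  (forall c x, V x -> phi (rscale c x) = c * phi x) ->
  (forall x, V x -> `|phi x| <= M * hnorm x) ->
  exists2 z, V z & forall v, V v -> phi v = rdot v z.
Proof.
move=> Vc Vs phiD phiZ phiM; have [V0 VD VZ] := Vs.
pose J x := hnorm x ^+ 2 - 2 * phi x.
have Jge x : V x -> - M ^+ 2 <= J x.
  move=> /phiM h; rewrite /J; have := sqr_ge0 (hnorm x - M).
  by have := ler_norm (phi x); nra.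
pose m := inf [set J x | x in V].
have Jinf : has_inf [set J x | x in V].
  split; first by exists (J 0), 0.
  by exists (- M ^+ 2) => _ [x Vx <-]; exact: Jge.
have mJ x : V x -> m <= J x by move=> Vx; apply: ge_inf; [case: Jinf|exists x].
have /choice[u uP] (n : nat) : exists x, V x /\ J x < m + n.+1%:R^-1.
  have [|_ [x Vx <-] Jx] := inf_adherent _ Jinf (eps := n.+1%:R^-1); first by [].
  by exists x.
(* Parallelogram law for [J]: the part [-2 phi] is linear and drops out. *)
have Jmid x y : V x -> V y ->
    J x + J y = 2 * J (rscale 2^-1 (x + y)) + hnorm (x - y) ^+ 2 / 2.
  move=> Vx Vy; rewrite /J hnorm_rscale phiZ ?phiD //; last exact: VD.
  by rewrite exprMn real_normK ?num_real // hnorm_sqrB hnorm_sqrD; field.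
have [z uz] : exists z, hnorm (u n - z) @[n --> \oo] --> (0 : R).
  apply: hcauchy_cvg => e e0.
  (* By [Jmid], half of [|u i - u j|^2] is at most the sum of the two excesses over [m], each below
     [e^2 / 4]. *)
  have e4 : 0 < e ^+ 2 / 4 by apply: divr_gt0; rewrite // exprn_gt0.
  have /cvgr0Pnorm_lt /(_ _ e4)[N _ NP] := @cvg_harmonic R.
  exists N => i j iN jN; rewrite -(ltr_pXn2r (n := 2)) ?nnegrE ?hnorm_ge0 ?(ltW e0) //.
  have := NP i iN; have := NP j jN; rewrite /= !ger0_norm //.
  have [Vi Ji] := uP i; have [Vj Jj] := uP j.
  have := mJ _ (VZ 2^-1 _ (VD _ _ Vi Vj)); have := Jmid _ _ Vi Vj.
  move: Ji Jj; set a := i.+1%:R^-1; set b := j.+1%:R^-1; clearbody a b J.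
  lra.
have Vz : V z by apply: closed_hcvg uz => // n; have [] := uP n.
exists z => // v Vv; apply/eqP; rewrite eq_sym -subr_eq0; apply/eqP.
apply: (@linear_coef_eq0 _ (hnorm v ^+ 2)) => [|c]; first exact: sqr_ge0.
rewrite (rdotC v z).
(* Comparing [J (u n + c v) >= m] with [J (u n) < m + 1/(n+1)] cancels [phi (u n)], so only the
   continuity of the inner product is needed in the limit. *)
have lim : 2 * c * (rdot (u n) v - phi v) + c ^+ 2 * hnorm v ^+ 2 + n.+1%:R^-1
    @[n --> \oo] --> 2 * c * (rdot z v - phi v) + c ^+ 2 * hnorm v ^+ 2 + 0.
  apply: cvgD; last exact: cvg_harmonic.
  apply: cvgD; last exact: cvg_cst.
  apply: cvgMr; apply: cvgB; last exact: cvg_cst.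
  exact: rdot_cvg.
rewrite -[leRHS]addr0 -(cvg_lim _ lim) //.
apply: limr_ge; first by apply/cvg_ex; eexists; exact: lim.
apply: nearW => n; have [Vn Jn] := uP n.
have := mJ _ (VD _ _ Vn (VZ c _ Vv)).
move: Jn; rewrite /J hnorm_sqrD rdotZr hnorm_rscale exprMn real_normK ?num_real //.
rewrite phiD ?phiZ //; last exact: VZ.
by set a := n.+1%:R^-1; clearbody a; lra.
Qed.

End RealInnerProduct.

(** * Linear maps and the operator norm *)

Section LinearMaps.
Context {R : realType} {s : scalars} {X Y : hilbert R s} {A : X -> Y}.
Hypothesis lA : linear A.

Lemma linearmapD x y : A (x + y) = A x + A y.
Proof. exact: (linearD (linear_pack lA)). Qed.

Lemma linearmapN x : A (- x) = - A x.
Proof. exact: (linearN (linear_pack lA)). Qed.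

Lemma linearmapB x y : A (x - y) = A x - A y.
Proof. exact: (linearB (linear_pack lA)). Qed.

Lemma linearmap0 : A 0 = 0.
Proof. exact: (linear0 (linear_pack lA)). Qed.

Lemma linearmapZ c x : A (rscale c x) = rscale c (A x).
Proof. exact: (linearZ_LR (linear_pack lA)). Qed.

Lemma linear_range : rsubspace (range A).
Proof.
split; first by exists 0; rewrite ?linearmap0.
- by move=> _ _ [x _ <-] [y _ <-]; exists (x + y); rewrite ?linearmapD.
- by move=> c _ [x _ <-]; exists (rscale c x); rewrite ?linearmapZ.
Qed.

Lemma linear_cancel (A' : Y -> X) : cancel A A' -> cancel A' A -> linear A'.
Proof.
move=> K K' a u v; apply: (can_inj K).
have lAa : A (a *: A' u + A' v) = a *: A (A' u) + A (A' v) by exact: lA.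
by rewrite K' lAa !K'.
Qed.

Hypothesis bA : hbounded A.

Lemma opnorm_has_sup : has_sup [set hnorm (A x) | x in [set x : X | hnorm x <= 1]].
Proof.
split; first by exists (hnorm (A 0)), 0; rewrite //= hnorm0.
have [M M0 AM] := bA; exists M => _ [x /= x1 <-].
by apply: le_trans (AM x) _; rewrite ler_piMr.
Qed.

Lemma opnorm_ge0 : 0 <= opnorm A.
Proof.
apply: (@le_trans _ _ (hnorm (A 0))); first exact: hnorm_ge0.
by apply: (sup_upper_bound opnorm_has_sup); exists 0; rewrite //= hnorm0.
Qed.

Lemma opnormP x : hnorm (A x) <= opnorm A * hnorm x.
Proof.
have [->|/eqP/hnorm_gt0 x0] := eqVneq x 0; first by rewrite linearmap0 !hnorm0 mulr0.
rewrite -ler_pdivrMr // mulrC.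
have -> : (hnorm x)^-1 * hnorm (A x) = hnorm (A (rscale (hnorm x)^-1 x)).
  by rewrite linearmapZ hnorm_rscale ger0_norm // invr_ge0 ltW.
apply: (sup_upper_bound opnorm_has_sup); exists (rscale (hnorm x)^-1 x) => //=.
by rewrite hnorm_rscale ger0_norm ?invr_ge0 ?hnorm_ge0 // mulVf // gt_eqF.
Qed.

End LinearMaps.

(** * Bounded inverses *)

Section Inverses.
Context {R : realType} {s : scalars}.
Implicit Types X Y Z : hilbert R s.

Lemma linear_comp X Y Z (A : X -> Y) (B : Y -> Z) : linear A -> linear B -> linear (B \o A).
Proof. by move=> lA lB a u v /=; rewrite lA lB. Qed.

Lemma hbounded_comp X Y Z (A : X -> Y) (B : Y -> Z) :
  hbounded A -> hbounded B -> hbounded (B \o A).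
Proof.
move=> [M M0 AM] [N N0 BN]; exists (N * M); first exact: mulr_ge0.
by move=> x /=; apply: le_trans (BN _) _; rewrite -mulrA ler_wpM2l.
Qed.

Lemma hbounded_sub X Y (A B : X -> Y) : hbounded A -> hbounded B -> hbounded (A \- B).
Proof.
move=> [M M0 AM] [N N0 BN]; exists (M + N); first exact: addr_ge0.
by move=> x /=; apply: le_trans (hnormD _ _) _; rewrite hnorm_opp mulrDl lerD.
Qed.

Lemma hbounded_id X : hbounded (@id X).
Proof. by exists 1 => // x; rewrite mul1r. Qed.

Lemma linear_sub X Y (A B : X -> Y) : linear A -> linear B -> linear (A \- B).
Proof. by move=> lA lB a u v /=; rewrite lA lB scalerBr opprD addrACA. Qed.

Lemma opinvK X Y (A : X -> Y) : injective A -> cancel A (opinv A).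
Proof. by move=> iA x; apply: pinvKV; rewrite ?in_setT // => u v _ _; exact: iA. Qed.

Lemma opinvKV X Y (A : X -> Y) : (forall y, exists x, A x = y) -> cancel (opinv A) A.
Proof.
move=> sA y; apply: pinvK; have [x <-] := sA y.
by apply/mem_set; exists x.
Qed.

Lemma invertible_opP X Y (A : X -> Y) : invertible_op A ->
  [/\ linear A, hbounded A, linear (opinv A) /\ hbounded (opinv A),
      cancel A (opinv A) & cancel (opinv A) A].
Proof.
move=> [lA cA [A' [cA' K K']]].
have -> : opinv A = A'.
  apply/funext => y; apply: (can_inj K); rewrite K'.
  by apply: opinvKV => z; exists (A' z).
have lA' := linear_cancel lA K K'.
by split => //; [exact: continuous_hbounded|split=> //; exact: continuous_hbounded].
Qed.

Lemma invertible_op_of X Y (A : X -> Y) (A' : Y -> X) : linear A -> hbounded A ->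
  hbounded A' -> cancel A A' -> cancel A' A -> invertible_op A.
Proof.
move=> lA bA bA' K K'; split=> //; first exact: hbounded_continuous.
by exists A'; split=> //; apply: hbounded_continuous => //; exact: linear_cancel K K'.
Qed.

Lemma invertible_op_comp X Y Z (A : X -> Y) (B : Y -> Z) :
  invertible_op A -> invertible_op B -> invertible_op (B \o A).
Proof.
move=> /invertible_opP[lA bA [_ bA'] KA KA'] /invertible_opP[lB bB [_ bB'] KB KB'].
apply: (@invertible_op_of _ _ _ (opinv A \o opinv B)).
- exact: linear_comp.
- exact: hbounded_comp.
- exact: hbounded_comp.
- exact: can_comp.
- exact: can_comp.
Qed.

End Inverses.

(** * Adjoint and Gram operator *)

Section Adjoint.
Context {R : realType} {s : scalars} {X Y : hilbert R s} {A : X -> Y}.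
Hypotheses (lA : linear A) (bA : hbounded A).

(** Riesz representation of [x |-> <A x, y>] on the whole space provides the vector that [get]
    selects. *)
Lemma dot_adjoint x y : dot Y (A x) y = dot X x (adjoint A y).
Proof.
rewrite /adjoint; set S := [set z | _].
suff /getPex /(_ x) : exists z, S z by [].
have [M M0 AM] := bA.
have [|||||z _ zP] := @riesz_subspace _ _ X setT (fun x => rdot (A x) y) (hnorm y * M).
- exact: closedT.
- by split.
- by move=> u v _ _; rewrite linearmapD // rdotDl.
- by move=> c u _; rewrite linearmapZ // rdotZl.
- move=> u _; apply: le_trans (rdot_le _ _) _.
  by rewrite mulrC -mulrA ler_wpM2l // hnorm_ge0.
(* Riesz only gives equality of real parts. For the defect [d] at [u], testing with
   [scal_conj d *: u] turns the defect into [scal_conj d * d], whose real part vanishes only if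
   [d = 0]. *)
exists z => u; apply/subr0_eq/scal_re_conjM_eq0.
set d := (_ - _).
have /eqP := zP (scal_conj d *: u) I; rewrite -subr_eq0 => /eqP <-.
have -> : A (scal_conj d *: u) = scal_conj d *: A u by exact: (linearZ_LR (linear_pack lA)).
rewrite /rdot !linearZl_LR /= -scal_reN -scal_reD; congr scal_re.
by rewrite -mulrBr.
Qed.

Lemma dot_eq (x y : X) : (forall v, dot X v x = dot X v y) -> x = y.
Proof. by move=> xy; apply: rdot_eq => v; rewrite /rdot xy. Qed.

Lemma rdot_adjoint x y : rdot (A x) y = rdot x (adjoint A y).
Proof. by rewrite /rdot dot_adjoint. Qed.

Lemma adjoint_linear : linear (adjoint A).
Proof.
move=> a u v; apply: dot_eq => w.
rewrite -dot_adjoint.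
by rewrite !linearPr /= -!dot_adjoint.
Qed.

Lemma adjoint_hbounded : hbounded (adjoint A).
Proof.
have [M M0 AM] := bA; exists M => // y.
have [->|/eqP/hnorm_gt0 y0] := eqVneq (adjoint A y) 0.
  by rewrite hnorm0 mulr_ge0 ?hnorm_ge0.
rewrite -(ler_pM2l y0) -expr2 -rdotxx -rdot_adjoint.
apply: le_trans (ler_norm _) _; apply: le_trans (rdot_le _ _) _.
by rewrite mulrA ler_wpM2r ?hnorm_ge0 // mulrC.
Qed.

Lemma gram_linear : linear (gram A).
Proof. exact: linear_comp adjoint_linear. Qed.

Lemma gram_hbounded : hbounded (gram A).
Proof. exact: hbounded_comp adjoint_hbounded. Qed.

Lemma rdot_gram x y : rdot x (gram A y) = rdot (A x) (A y).
Proof. by rewrite rdot_adjoint. Qed.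

End Adjoint.

(** * Uniform boundedness by a gliding hump *)

Section UniformBoundedness.
Context {R : realType} {s : scalars} {Y : hilbert R s}.
Implicit Types (y w : Y).

(* One step of the gliding hump: the sign makes the two contributions add up. *)
Definition hump y w (c : R) : Y :=
  y + rscale ((if 0 <= rdot y w then 1 else -1) * c / hnorm w) w.

Lemma hump_rdot y w c : w <> 0 -> 0 <= c -> c * hnorm w <= `|rdot (hump y w c) w|.
Proof.
move=> /hnorm_gt0 w0 c0; rewrite /hump rdotDl rdotZl rdotxx.
set e := (if _ then _ else _).
have -> : e * c / hnorm w * hnorm w ^+ 2 = e * (c * hnorm w).
  by field; rewrite gt_eqF.
have cw : 0 <= c * hnorm w by rewrite mulr_ge0 // ltW.
rewrite /e; case: ifPn => [d0|]; first by rewrite mul1r ger0_norm; lra.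
by rewrite -ltNge => d0; rewrite mulN1r ler0_norm; lra.
Qed.

Lemma hump_dist y w c : w <> 0 -> 0 <= c -> hnorm (hump y w c - y) = c.
Proof.
move=> /hnorm_gt0 w0 c0; rewrite /hump addrC addKr hnorm_rscale !normrM.
rewrite normfV (ger0_norm c0) (ger0_norm (ltW w0)) divfK ?gt_eqF //.
by case: ifP => _; rewrite ?normrN normr1 mul1r.
Qed.

(** If [W] were unbounded, pick [w n] in [W] with norms outgrowing [3^n] and let [y] move by
    [3^-(n+1)] along [w n]. All later moves undo at most half of this hump, so the limit [z] of [y]
    has [|<z, w n>| > n] for every [n]. *)
Lemma weakly_bounded (W : set Y) :
  (forall y, exists M : R, forall w, W w -> `|rdot y w| <= M) ->
  exists M : R, forall w, W w -> hnorm w <= M.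
Proof.
move=> Wb; apply: contrapT => /forallNP Wu.
have big (M : R) : exists w, W w /\ M < hnorm w.
  have /existsNP[w /not_implyP[Ww wM]] := Wu M.
  by exists w; split => //; rewrite ltNge; apply/negP.
(* With ratio 1/3 the steps after a given one sum to half of it. *)
pose q : R := 3^-1.
have q0 n : 0 < q ^+ n by rewrite exprn_gt0 // invr_gt0.
(* The threshold makes half of the hump, [q^(n+1) |w n| / 2], exceed [n]. For [n = 0] it is 0, and
   the strict inequality still gives [w 0 <> 0]. *)
have /choice[w wP] (n : nat) : exists w, W w /\ n%:R * 2 / q ^+ n.+1 < hnorm w by exact: big.
have w0 n : w n <> 0.
  move=> w0; have [_] := wP n; rewrite w0 hnorm0 ltNge => /negP; apply.
  by rewrite divr_ge0 ?mulr_ge0 ?(ltW (q0 _)).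
pose y := fix y n := if n is n'.+1 then hump (y n') (w n') (q ^+ n'.+1) else 0 : Y.
have yS n : hnorm (y n.+1 - y n) = q ^+ n.+1 by apply: hump_dist; rewrite // ltW.
have yD n k : hnorm (y (n + k)%N - y n) <= (q ^+ n - q ^+ (n + k)) / 2.
  elim: k => [|k IH]; first by rewrite addn0 !subrr hnorm0 mul0r.
  rewrite addnS; apply: le_trans (hnorm_tri _ (y (n + k)%N) _) _.
  rewrite yS; have -> : q ^+ (n + k).+1 = 3^-1 * q ^+ (n + k) by rewrite exprS.
  lra.
have yD' n m : (n <= m)%N -> hnorm (y m - y n) <= q ^+ n / 2.
  by move=> /subnKC<-; apply: le_trans (yD _ _) _; have := q0 (n + (m - n))%N; lra.
have q_cvg : q ^+ n @[n --> \oo] --> (0 : R).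
  by apply: cvg_expr; rewrite ger0_norm ?invr_ge0 // invf_lt1 ?ltr1n.
have [z yz] : exists z, hnorm (y n - z) @[n --> \oo] --> (0 : R).
  apply: hcauchy_cvg => e e0; have /cvgr0Pnorm_lt /(_ _ e0)[N _ NP] := q_cvg.
  exists N => i j iN jN; have := NP N (leqnn N); rewrite /= ger0_norm; last exact/ltW.
  move=> qe; apply: le_lt_trans (hnorm_tri _ (y N) _) _; rewrite (hdistC (y N)).
  have := yD' _ _ iN; have := yD' _ _ jN; lra.
have zD n : hnorm (z - y n) <= q ^+ n / 2.
  have lim : hnorm (y m - z) + q ^+ n / 2 @[m --> \oo] --> 0 + q ^+ n / 2.
    by apply: cvgD => //; exact: cvg_cst.
  rewrite -[leRHS]add0r -(cvg_lim _ lim) //.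
  apply: limr_ge; first by apply/cvg_ex; eexists; exact: lim.
  near=> m; apply: le_trans (hnorm_tri _ (y m) _) _; rewrite (hdistC z) lerD2l.
  by apply: yD'; near: m; exists n.
have [M zM] := Wb z.
have [n Mn] : exists n : nat, M < n%:R.
  by exists (Num.truncn M).+1; exact: truncnS_gt.
have [Ww wn] := wP n; have := zM _ Ww.
have h1 := hump_rdot (y n) (w0 n) (ltW (q0 n.+1)).
have h2 : `|rdot (y n.+1 - z) (w n)| <= q ^+ n.+1 / 2 * hnorm (w n).
  apply: le_trans (rdot_le _ _) _; rewrite ler_wpM2r ?hnorm_ge0 //.
  by rewrite hdistC; exact: zD.
have h3 : `|rdot (y n.+1) (w n)| <= `|rdot (y n.+1 - z) (w n)| + `|rdot z (w n)|.
  by apply: le_trans (ler_normD _ _); rewrite rdotDl rdotNl subrK.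
have h4 : n%:R * 2 < hnorm (w n) * q ^+ n.+1 by rewrite -ltr_pdivrMr.
have : q ^+ n.+1 * hnorm (w n) <= `|rdot (y n.+1) (w n)| by exact: h1.
clear -h2 h3 h4 Mn; move: (q ^+ n.+1) (hnorm (w n)) h2 h4 => a b; nra.
Unshelve. all: by end_near. Qed.

End UniformBoundedness.

(** * Injective operators with closed range are bounded below *)

Section BoundedBelow.
Context {R : realType} {s : scalars} {X Y : hilbert R s} {A : X -> Y}.
Hypotheses (lA : linear A) (bA : hbounded A) (cA : closed (range A)).

(** The norm bound on [W], applied to [A x] divided by [|gram A x|], is the estimate; it remains to
    see that [W] is weakly bounded. *)
Lemma adjoint_range_below :
  exists2 M : R, 0 < M & forall x, hnorm (A x) <= M * hnorm (gram A x).
Proof.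
pose W := [set w | range A w /\ hnorm (adjoint A w) <= 1].
have [y|M WM] := @weakly_bounded _ _ _ W.
  (* The representing vector in [range A] is the projection [A x] of [y]. For [w] in [W],
     [<w, y> = <w, A x> = <adjoint A w, x>], which is at most [|x|]. *)
  have [|x y' _ _|c x _|x _|_ [x _ <-] xP] :=
      @riesz_subspace _ _ Y (range A) (fun v => rdot v y) (hnorm y) cA.
  - exact: linear_range.
  - exact: rdotDl.
  - exact: rdotZl.
  - by rewrite mulrC; exact: rdot_le.
  exists (hnorm x) => w [Aw w1]; rewrite rdotC xP // rdotC rdot_adjoint //.
  by apply: le_trans (rdot_le _ _) _; rewrite ler_piMr ?hnorm_ge0.
exists (`|M| + 1) => [|x]; first by rewrite ltr_wpDl.
have [Gx0|/eqP/hnorm_gt0 Gx] := eqVneq (gram A x) 0.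
  have /eqP : hnorm (A x) ^+ 2 = 0.
    by rewrite -rdotxx -rdot_gram // Gx0 rdotC rdot0l.
  by rewrite sqrf_eq0 => /eqP->; rewrite mulr_ge0 ?hnorm_ge0 // addr_ge0.
have c0 : 0 <= (hnorm (gram A x))^-1 by rewrite invr_ge0 ltW.
have := WM (rscale (hnorm (gram A x))^-1 (A x)).
have /[swap]/[apply] : W (rscale (hnorm (gram A x))^-1 (A x)).
  split; first by exists (rscale (hnorm (gram A x))^-1 x); rewrite ?linearmapZ.
  rewrite (linearmapZ (adjoint_linear lA bA)) hnorm_rscale ger0_norm //.
  by rewrite -[adjoint A _]/(gram A x) mulVf // gt_eqF.
rewrite hnorm_rscale ger0_norm // mulrC ler_pdivrMr // => /le_trans; apply.
by rewrite ler_wpM2r ?hnorm_ge0 //; have := ler_norm M; lra.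
Qed.

Hypothesis iA : injective A.

(** Let [z] be the projection of [x] onto the closure [V] of the range of [gram A]. Then [x - z] is
    orthogonal to [gram A (x - z)], that is, [A (x - z) = 0], and injectivity gives [x = z]. *)
Lemma gram_dense (x : X) (e : R) : 0 < e -> exists u, hnorm (x - gram A u) < e.
Proof.
pose V := [set x | forall e : R, 0 < e -> exists u, hnorm (x - gram A u) < e].
suff : V x by apply.
have lG := gram_linear lA bA.
have VG u : V (gram A u) by move=> d d0; exists u; rewrite subrr hnorm0.
have Vs : rsubspace V.
  split.
  - by rewrite -(linearmap0 lG); exact: VG.
  - move=> u v Vu Vv d d0; have d2 : 0 < d / 2 by lra.
    have [u' u'P] := Vu _ d2; have [v' v'P] := Vv _ d2; exists (u' + v').
    rewrite (linearmapD lG) opprD addrACA; apply: le_lt_trans (hnormD _ _) _; lra.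
  - move=> c u Vu d d0; have c0 : 0 < `|c| + 1 by rewrite ltr_wpDl.
    have [|u' u'P] := Vu (d / (`|c| + 1)); first exact: divr_gt0.
    exists (rscale c u'); rewrite (linearmapZ lG) /rscale -scalerBr -/(rscale _ _).
    rewrite hnorm_rscale; move: u'P; rewrite ltr_pdivlMr //.
    by have := hnorm_ge0 (u - gram A u'); have := normr_ge0 c; nra.
have Vc : closed V.
  move=> u uV d d0; have d2 : 0 < d / 2 by lra.
  have d2' : 0 < of_real s (d / 2) by rewrite -(of_real0 (R := R) (s := s)) of_real_lt.
  have [v [Vv]] := uV _ (nbhsx_ballx u _ d2').
  rewrite -ball_normE /= hnormE of_real_lt => uv.
  have [w vw] := Vv _ d2; exists w.
  by apply: le_lt_trans (hnorm_tri _ v _) _; lra.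
have [u v _ _|c u _|u _|z Vz zP] :=
    @riesz_subspace _ _ X V (fun v => rdot v x) (hnorm x) Vc Vs.
- exact: rdotDl.
- exact: rdotZl.
- by rewrite mulrC; exact: rdot_le.
have -> : x = z; last exact: Vz.
apply/subr0_eq/iA; rewrite linearmap0 //; apply/hnorm_eq0/eqP; rewrite -sqrf_eq0 -rdotxx.
rewrite -rdot_gram // rdotC rdotDr rdotNr.
by rewrite zP ?subrr; [|exact: VG].
Qed.

(** For [gram A u] close to [x], [|x|^2] is nearly [<gram A u, x> = <A u, A x>], which is at most
    [M |gram A u| |A x|], hence nearly at most [M |x| |A x|]. *)
Lemma bounded_below : exists2 c : R, 0 < c & forall x, c * hnorm x <= hnorm (A x).
Proof.
have [M M0 AM] := adjoint_range_below; exists M^-1 => [|x]; first by rewrite invr_gt0.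
rewrite mulrC ler_pdivrMr //.
have [->|/eqP/hnorm_gt0 x0] := eqVneq x 0; first by rewrite hnorm0 mulr_ge0 ?hnorm_ge0 // ltW.
rewrite -(ler_pM2l x0); apply/ler_addgt0Pr => e e0.
(* The error [|x - gram A u|] enters the final estimate with coefficient [|x| + M |A x|]; the added
   1 keeps [D] positive. *)
pose D := hnorm x + M * hnorm (A x) + 1.
have D0 : 0 < D.
  by rewrite ltr_wpDl // addr_ge0 ?hnorm_ge0 // mulr_ge0 ?hnorm_ge0 // ltW.
have [u uP] := gram_dense x (divr_gt0 e0 D0).
have GU : hnorm (gram A u) <= hnorm x + hnorm (x - gram A u).
  rewrite {1}(_ : gram A u = x - (x - gram A u)); last by rewrite subKr.
  by apply: le_trans (hnormD _ _) _; rewrite hnorm_opp.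
have : hnorm x ^+ 2 <= hnorm (x - gram A u) * hnorm x + hnorm (A x) * hnorm (A u).
  rewrite -rdotxx -[X in rdot X _](subrK (gram A u)) rdotDl (rdotC (gram A u)) rdot_gram //.
  by apply: lerD; apply: le_trans (ler_norm _) (rdot_le _ _).
have := AM u; move: uP GU; rewrite ltr_pdivlMr // /D expr2.
have := hnorm_ge0 (A x); have := hnorm_ge0 (x - gram A u).
move: (hnorm (A x)) (hnorm (A u)) (hnorm x) (hnorm (gram A u)) (hnorm (x - gram A u)) x0.
move=> a a' n g d n0 d0 a0 de gnd a'g n2.
have a'M : a * a' <= a * (M * (n + d)).
  by rewrite ler_wpM2l //; apply: le_trans a'g _; rewrite ler_pM2l.
nra.
Qed.

End BoundedBelow.

(** * The Moore-Penrose inverse of an operator bounded below *)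

Section MoorePenrose.
Context {R : realType} {s : scalars} {X Y : hilbert R s} {A : X -> Y}.
Hypotheses (lA : linear A) (bA : hbounded A) (cA : closed (range A)).
Variable c : R.
Hypotheses (c0 : 0 < c) (Ac : forall x, c * hnorm x <= hnorm (A x)).

Lemma bounded_below_inj : injective A.
Proof.
move=> x y Axy; apply/subr0_eq/hnorm_eq0/le_anti; rewrite hnorm_ge0 andbT.
by have := Ac (x - y); rewrite linearmapB // Axy subrr hnorm0 pmulr_rle0.
Qed.

Lemma gram_bounded_below x : c ^+ 2 * hnorm x <= hnorm (gram A x).
Proof.
have [->|/eqP/hnorm_gt0 x0] := eqVneq x 0; first by rewrite hnorm0 mulr0 hnorm_ge0.
rewrite -(ler_pM2l x0); apply: (@le_trans _ _ (rdot x (gram A x))); last first.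
  by apply: le_trans (ler_norm _) (rdot_le _ _).
rewrite rdot_gram // rdotxx mulrCA -expr2 -exprMn.
by rewrite lerXn2r ?nnegrE ?mulr_ge0 ?hnorm_ge0 // ltW.
Qed.

(** Represent [y |-> <A^-1 y, v>], bounded on the closed subspace [range A], by a vector [A u] of
    that subspace: then [<x, v> = <A x, A u> = <x, gram A u>] for all [x]. *)
Lemma gram_surj v : exists u, gram A u = v.
Proof.
have iA := bounded_below_inj.
have gK := opinvK iA; pose g := opinv A.
have [_ _ [x _ <-] [y _ <-]|a _ [x _ <-]|_ [x _ <-]|_ [u _ <-] uP] :=
  @riesz_subspace _ _ Y (range A) (fun y => rdot (g y) v) (hnorm v / c) cA (linear_range lA).
- by rewrite -linearmapD // /g !gK rdotDl.
- by rewrite -linearmapZ // /g !gK rdotZl.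
- rewrite /g gK; apply: le_trans (rdot_le _ _) _.
  by rewrite mulrC -mulrA ler_wpM2l ?hnorm_ge0 // ler_pdivlMl.
exists u; apply: rdot_eq => x; rewrite rdot_gram // -uP; last by exists x.
by rewrite /g gK.
Qed.

Lemma gram_invertible : invertible_op (gram A).
Proof.
have iG : injective (gram A).
  move=> x y Gxy; apply/subr0_eq/hnorm_eq0/le_anti; rewrite hnorm_ge0 andbT.
  have := gram_bounded_below (x - y).
  by rewrite (linearmapB (gram_linear lA bA)) Gxy subrr hnorm0 pmulr_rle0 ?exprn_gt0.
have GK' := opinvKV gram_surj.
apply: (invertible_op_of _ _ _ (opinvK iG) GK').
- exact: gram_linear.
- exact: gram_hbounded.
exists (c ^- 2) => [|y]; first by rewrite invr_ge0 exprn_ge0 // ltW.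
by rewrite ler_pdivlMl ?exprn_gt0 // -{2}(GK' y) gram_bounded_below.
Qed.

Lemma moore_penrose_linear : linear (moore_penrose A).
Proof.
have [_ _ [lG _] _ _] := invertible_opP gram_invertible.
exact: linear_comp (adjoint_linear lA bA) lG.
Qed.

(** For [u = moore_penrose A y], [|A u|^2 = <u, adjoint A y> = <A u, y>], so [|A u| <= |y|], and
    [c |u| <= |A u|]. *)
Lemma moore_penrose_le y : hnorm (moore_penrose A y) <= c^-1 * hnorm y.
Proof.
have [_ _ _ _ GK] := invertible_opP gram_invertible.
set u := moore_penrose A y; rewrite ler_pdivlMl //; apply: le_trans (Ac u) _.
have [->|Au0] := eqVneq (hnorm (A u)) 0; first exact: hnorm_ge0.
rewrite -(ler_pM2l (x := hnorm (A u))); last by rewrite lt_neqAle eq_sym Au0 hnorm_ge0.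
rewrite -expr2 -rdotxx -rdot_gram // /u /moore_penrose /= GK -rdot_adjoint //.
by apply: le_trans (ler_norm _) (rdot_le _ _).
Qed.

Lemma moore_penrose_hbounded : hbounded (moore_penrose A).
Proof. by exists c^-1; [rewrite invr_ge0 ltW|exact: moore_penrose_le]. Qed.

Lemma moore_penroseK : cancel A (moore_penrose A).
Proof.
have [_ _ _ GK _] := invertible_opP gram_invertible.
by move=> x; rewrite /moore_penrose /= -[adjoint A (A x)]/(gram A x) GK.
Qed.

Lemma gram_moore_penrose y : gram A (moore_penrose A y) = adjoint A y.
Proof.
have [_ _ _ _ GK] := invertible_opP gram_invertible.
by rewrite /moore_penrose /= GK.
Qed.

End MoorePenrose.

(** * Calculus of functions differentiable on a half-open interval *)

Section RealDerivative.
Context {R : realType}.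
Implicit Types (f g : R -> R).

Lemma is_derive_eps g (t a : R) :
  (forall e : R, 0 < e -> exists2 d : R, 0 < d &
     forall h, `|h| < d -> `|g (t + h) - g t - h * a| <= e * `|h|) ->
  is_derive t 1 g a.
Proof.
move=> gP; suff lim : h^-1 *: ((g \o shift t) (h *: 1) - g t) @[h --> 0^'] --> a.
  by apply: DeriveDef; [apply/cvg_ex; exists a|exact: cvg_lim lim].
apply/cvgrPdist_le => e e0; have [d d0 dP] := gP e e0.
near=> h.
have h0 : h != 0 by near: h; exact: nbhs_dnbhs_neq.
have hd : `|h| < d.
  near: h; apply: dnbhs0_lt; exact: d0.
rewrite /= /shift /= [h *: 1]mulr1 [h + t]addrC distrC.
have -> : h^-1 *: (g (t + h) - g t) - a = h^-1 * (g (t + h) - g t - h * a).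
  by rewrite /GRing.scale /=; field.
by rewrite normrM normfV mulrC ler_pdivrMr ?normr_gt0 // dP.
Unshelve. all: by end_near. Qed.

Lemma is_derive_le0 g g' : (forall t : R, 0 <= t <= 1 -> is_derive t 1 g (g' t)) ->
  (forall t : R, 0 <= t <= 1 -> g' t <= 0) -> g 1 <= g 0.
Proof.
move=> dg g'0.
have [||c] := @MVT R g g' 0 1 ltr01.
- by move=> t; rewrite in_itv /= => /andP[t0 t1]; apply: dg; rewrite (ltW t0) (ltW t1).
- apply: derivable_within_continuous => t; rewrite in_itv /= => t01.
  by have [] := dg t t01.
rewrite in_itv /= => /andP[c0 c1] E.
have cle : 0 <= c <= 1 by rewrite (ltW c0) (ltW c1).
by have := g'0 c cle; lra.
Qed.

(* Extends f to the left of 0 by its tangent, so that the one-sided derivative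
   at 0 becomes a two-sided one. *)
Definition tangent_ext f f' (t : R) : R := if t < 0 then f 0 + f' 0 * t else f t.

Lemma tangent_ext_ge0 f f' t : 0 <= t -> tangent_ext f f' t = f t.
Proof. by rewrite /tangent_ext ltNge => ->. Qed.

Variables (b : R) (f f' : R -> R).
Hypothesis hf : C1_halfopen b f f'.

Lemma C1_halfopen_eps t : 0 <= t < b -> forall e : R, 0 < e ->
  exists2 d : R, 0 < d & forall u : R, 0 <= u < b -> `|u - t| < d ->
    `|f u - f t - (u - t) * f' t| <= e * `|u - t|.
Proof.
move=> tb e e0; have /cvgrPdist_le /(_ e e0) := hf.1 t tb.
rewrite near_withinE => /nbhs_ballP[d /= d0 dP]; exists d => // u ub ud.
have [->|ut] := eqVneq u t; first by rewrite !subrr mul0r subrr normr0 mulr0.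
have := dP u; rewrite /ball /= distrC => /(_ ud).
have /[swap]/[apply] h : (`[0, b[%classic `\ t) u.
  by split=> [|/eqP]; [rewrite /= in_itv|exact/negP].
have ut0 : u - t != 0 by rewrite subr_eq0.
have -> : f u - f t - (u - t) * f' t = (u - t) * - (f' t - (f u - f t) / (u - t)) by field.
by rewrite normrM normrN mulrC ler_wpM2r.
Qed.

Lemma tangent_ext_derive t : 0 <= t < b -> is_derive t 1 (tangent_ext f f') (f' t).
Proof.
move=> tb; have /andP[t0 tltb] := tb.
apply: is_derive_eps => e e0; have [d d0 dP] := C1_halfopen_eps tb e0.
(* For [t > 0] the last bound keeps [t + h] nonnegative. At [t = 0] a negative [h] is allowed, since
   the extension coincides there with its tangent. *)
pose d' := Num.min (Num.min d (b - t)) (if t == 0 then 1 else t).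
have d'0 : 0 < d'.
  rewrite !lt_min d0 subr_gt0 tltb /=; case: eqVneq => // t0'.
  by rewrite lt_neqAle eq_sym t0'.
exists d' => // h; rewrite !lt_min => /andP[/andP[hd hb] ht].
rewrite (tangent_ext_ge0 _ _ t0) /tangent_ext.
case: ltP => [th|th].
  move: ht; case: eqVneq => [t0' _|_ ht]; last by have := ler_norm (- h); rewrite normrN; lra.
  have -> : f 0 + f' 0 * (t + h) - f t - h * f' t = 0 by rewrite t0'; ring.
  by rewrite normr0 mulr_ge0 // ltW.
have := dP (t + h); rewrite addrAC subrr add0r; apply=> //.
by rewrite th /=; have := ler_norm h; lra.
Qed.

Lemma C1_halfopen_cvg (u : nat -> R) l : (forall n, 0 <= u n < b) -> 0 <= l < b ->
  u n @[n --> \oo] --> l -> f (u n) @[n --> \oo] --> f l.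
Proof.
move=> ub /[dup] lb /andP[l0 _] ul; rewrite -(tangent_ext_ge0 f f' l0).
under eq_fun do rewrite -(tangent_ext_ge0 f f' (andP (ub _)).1).
have [dl _] := tangent_ext_derive lb.
by apply: (cvg_comp _ _ ul); apply/differentiable_continuous/derivable1_diffP.
Qed.

Lemma C1_halfopen_deriv_cvg (u : nat -> R) l : (forall n, 0 <= u n < b) -> 0 <= l < b ->
  u n @[n --> \oo] --> l -> f' (u n) @[n --> \oo] --> f' l.
Proof.
move=> ub lb ul; apply/cvgrPdist_lt => e e0.
have /subspace_continuousP /(_ l lb) /cvgrPdist_lt /(_ e e0) := hf.2.
rewrite near_withinE => /nbhs_ballP[d /= d0 dP].
move/cvgrPdist_lt: ul => /(_ d d0) ul; near=> n.
by apply: dP; [near: n|exact: ub].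
Unshelve. all: by end_near. Qed.

Hypothesis f'_incr : {in `[0, b[ &, {homo f' : u v / u < v}}.

Lemma C1_halfopen_mvt t : 0 < t < b -> exists2 c, 0 < c < t & f t = f 0 + t * f' c.
Proof.
move=> /andP[t0 tb]; have [||c] := @MVT R (tangent_ext f f') f' 0 t t0.
- move=> x; rewrite in_itv /= => /andP[x0 xt].
  by apply: tangent_ext_derive; rewrite (ltW x0) (lt_trans xt).
- apply: derivable_within_continuous => x; rewrite in_itv /= => /andP[x0 xt].
  have xb : 0 <= x < b by rewrite x0 (le_lt_trans xt).
  by have [] := tangent_ext_derive xb.
rewrite in_itv /= => ct; rewrite !tangent_ext_ge0 ?(ltW t0) // subr0 => E.
by exists c => //; lra.
Qed.

(** By the mean value theorem [f t - f 0 = t * f' c] with [c < t], and [f'] is strictly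
    increasing. *)
Lemma convex_gap t : 0 < t < b -> f t - f 0 < t * f' t.
Proof.
move=> tb; have [c /andP[c0 ct] ->] := C1_halfopen_mvt tb.
have /andP[t0 tltb] := tb; rewrite addrC addKr ltr_pM2l //.
by apply: f'_incr; rewrite ?in_itv //= ?(ltW c0) ?(ltW t0) //= (lt_trans ct).
Qed.

End RealDerivative.

(** * Linearisation error along a segment *)

Section MeanValue.
Context {R : realType} {s : scalars} {X Y : hilbert R s}.

Lemma differentiable_line (F : X -> Y) (x e : X) (w : Y) (t : R) :
  differentiable F (x + rscale t e) ->
  is_derive t 1 (fun u => rdot (F (x + rscale u e)) w) (rdot ('d F (x + rscale t e) e) w).
Proof.
move=> dF; apply: is_derive_eps => c c0.
have lF : linear ('d F (x + rscale t e)) by exact: linearP.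
pose N := hnorm e * hnorm w + 1.
have N0 : 0 < N by rewrite ltr_wpDl // mulr_ge0 ?hnorm_ge0.
have [d d0 dP] := differentiable_hnorm dF (divr_gt0 c0 N0).
have e1 : 0 < hnorm e + 1 by rewrite ltr_wpDl ?hnorm_ge0.
exists (d / (hnorm e + 1)) => [|h]; first exact: divr_gt0.
rewrite ltr_pdivlMr // => hd.
have /dP : hnorm (rscale h e) < d.
  rewrite hnorm_rscale; apply: le_lt_trans hd.
  by rewrite ler_wpM2l // lerDl.
rewrite hnorm_rscale -(addrA x) -rscaleDl (linearmapZ lF) => le1.
rewrite -rdotZl -rdotNl -rdotNl -!rdotDl.
apply: le_trans (rdot_le _ _) _.
apply: le_trans (ler_wpM2r (hnorm_ge0 _) le1) _.
have -> : c / N * (`|h| * hnorm e) * hnorm w = c * `|h| * ((hnorm e * hnorm w) / N).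
  by field; rewrite gt_eqF.
apply: ler_piMr; first by rewrite mulr_ge0 // ltW.
by rewrite ler_pdivrMr // mul1r lerDl.
Qed.

(** This replaces the integral of the majorant condition: pairing with the error vector [w] itself
    reduces the vector estimate to the monotonicity of a real function [g] on [[0, 1]]. *)
Lemma majorant_mean_value (F : X -> Y) (x e : X) (L : Y) (b c : R) (f f' : R -> R) :
  0 <= c -> 0 < hnorm e < b -> C1_halfopen b f f' -> f 0 = 0 ->
  {in `[0, b[ &, {homo f' : u v / u < v}} -> F x = 0 ->
  (forall t : R, 0 <= t <= 1 -> differentiable F (x + rscale t e)) ->
  (forall t : R, 0 <= t <= 1 -> c * hnorm (L - 'd F (x + rscale t e) e) <=
     (f' (hnorm e) - f' (t * hnorm e)) * hnorm e) ->
  c * hnorm (L - F (x + e)) <= hnorm e * f' (hnorm e) - f (hnorm e).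
Proof.
move=> c0 eb hf f0 f'_incr F0 dF dFL; have /andP[e0 eltb] := eb.
have gap := convex_gap hf f'_incr eb; rewrite f0 subr0 in gap.
set w := L - F (x + e); set T := hnorm e in e0 eltb eb dFL gap *.
have [w0|/eqP/hnorm_gt0 w0] := eqVneq w 0; first by rewrite w0 hnorm0 mulr0 subr_ge0 ltW.
(* Here [g 0 = 0], and [g 1] is [|w|] times the difference of the two sides of the claim. The
   hypothesis on derivatives and Cauchy-Schwarz make [g'] nonpositive. *)
pose g t := c * (t * rdot L w - rdot (F (x + rscale t e)) w)
  - hnorm w * (t * (T * f' T) - tangent_ext f f' (t * T)).
pose g' t := c * (rdot L w - rdot ('d F (x + rscale t e) e) w)
  - hnorm w * (T * f' T - T * f' (t * T)).
have gle : g 1 <= g 0.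
  apply: (@is_derive_le0 _ g g') => t t01.
    have tT : 0 <= t * T < b.
      have /andP[t0 t1] := t01; rewrite mulr_ge0 ?(ltW e0) //=.
      by apply: le_lt_trans eltb; rewrite ler_piMl // ltW.
    have d1 := differentiable_line w (dF t t01).
    have d2 := tangent_ext_derive hf tT.
    pose phi (u : R) := rdot (F (x + rscale u e)) w.
    pose psi (u : R) := tangent_ext f f' (u * T).
    have dpsi : is_derive t 1 psi (f' (t * T) * T).
      apply: (@is_derive1_comp _ (tangent_ext f f') (fun u => u * T)).
      have -> : (fun u => u * T) = T *: id by apply/funext => u; exact: mulrC.
      by apply: is_derive_eq; rewrite /GRing.scale /= mulr1.
    have -> : g = c *: (rdot L w *: id - phi) - hnorm w *: ((T * f' T) *: id - psi).
      by apply/funext => u; rewrite /g !fctE /GRing.scale /= /phi /psi; ring.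
    apply: is_derive_eq; rewrite /g' /GRing.scale /=; ring.
  have := dFL t t01; rewrite /g' -rdotNl -rdotDl => h.
  have := rdot_le (L - 'd F (x + rscale t e) e) w.
  move=> /(le_trans (ler_norm _)) /(ler_wpM2l c0) h2.
  rewrite subr_le0; apply: le_trans h2 _; rewrite mulrA.
  by rewrite [leRHS]mulrC ler_wpM2r ?hnorm_ge0 //; lra.
move: gle; rewrite /g mul1r rscale1 rscale0 addr0 F0 rdot0l !mul0r !mul1r.
rewrite !tangent_ext_ge0 ?(ltW e0) // f0 !subr0 !mulr0 subr0 -rdotNl -rdotDl rdotxx.
have -> : c * hnorm w ^+ 2 - hnorm w * (T * f' T - f T) =
    hnorm w * (c * hnorm w - (T * f' T - f T)) by ring.
by rewrite pmulr_rle0 // subr_le0.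
Qed.

End MeanValue.

(** * Error of one inexact step *)

Section Step.
Context {R : realType} {s : scalars} {X Y : hilbert R s}.

(* With q = A^+ y and e the current error, the new error splits as
   (e - B^-1 G e) + B^-1 G (e - q) + B^-1 res, where G = A^* A, and
   B^-1 res = B^-1 G (P G)^-1 (P res). *)
Lemma inexact_step_le (A : X -> Y) (B P : X -> X) (e dx res : X) (y : Y)
    (c theta vth w1 w2 n : R) :
  linear A -> hbounded A -> closed (range A) ->
  0 < c -> (forall x, c * hnorm x <= hnorm (A x)) ->
  invertible_op B -> invertible_op P ->
  B dx = - adjoint A y + res ->
  opnorm (opinv B \o gram A) <= w1 -> opnorm ((opinv B \o gram A) \- id) <= w2 ->
  hnorm (P res) <= theta * hnorm (P (adjoint A y)) ->
  0 <= theta * cond (P \o gram A) <= vth ->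
  hnorm (e - moore_penrose A y) <= n ->
  hnorm (e + dx) <= (1 + vth) * w1 * n + (w1 * vth + w2) * hnorm e.
Proof.
move=> lA bA cA c0 Ac iB iP Bdx Bw1 Bw2 Pres tcond qn.
have iG := gram_invertible lA bA cA c0 Ac.
have iPG := invertible_op_comp iG iP.
have [lB bB [lBi bBi] BK _] := invertible_opP iB.
have [lP bP _ PK _] := invertible_opP iP.
have [lG bG _ GK GK'] := invertible_opP iG.
have [lPG bPG [lPGi bPGi] PGK PGK'] := invertible_opP iPG.
have lBG := linear_comp lG lBi; have bBG := hbounded_comp bG bBi.
set q := moore_penrose A y in qn; pose v := opinv (P \o gram A) (P res).
have Gq : gram A q = adjoint A y by exact: gram_moore_penrose c0 Ac _.
have Gv : gram A v = res by apply: (can_inj PK); exact: PGK'.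
have lid : linear (@id X) by move=> ? ? ?.
have w1_ge0 : 0 <= w1 by apply: le_trans Bw1; exact: opnorm_ge0.
have vth0 : 0 <= vth by case/andP: tcond => /le_trans; apply.
have vq : hnorm v <= vth * hnorm q.
  (* The hypothesis controls only the product with [cond], so the sign of [theta] is open; a
     negative [theta] forces [P res = 0]. *)
  have [theta0|theta0] := leP 0 theta; last first.
    have -> : v = 0.
      rewrite /v (_ : P res = 0) ?(linearmap0 lPGi) //.
      apply/hnorm_eq0/le_anti; rewrite hnorm_ge0 andbT; apply: le_trans Pres _.
      by rewrite nmulr_rle0 // hnorm_ge0.
    by rewrite hnorm0 mulr_ge0 // hnorm_ge0.
  (* Since [adjoint A y = G q], [|v|] is at most [theta |(P G)^-1| |P G q|], which produces the
     condition number. *)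
  apply: (@le_trans _ _ (theta * cond (P \o gram A) * hnorm q)); last first.
    by rewrite ler_wpM2r ?hnorm_ge0 //; case/andP: tcond.
  apply: le_trans (opnormP lPGi bPGi _) _.
  have inv0 := opnorm_ge0 bPGi.
  apply: le_trans (ler_wpM2l inv0 Pres) _; rewrite -Gq.
  have := ler_wpM2l (mulr_ge0 inv0 theta0) (opnormP lPG bPG q).
  by rewrite /cond /=; lra.
(* This splits the residual contribution [w1 vth |q|] into the extra [vth w1 n] and the term
   [w1 vth |e|]. *)
have qle : hnorm q <= n + hnorm e.
  rewrite -(subKr e q); apply: le_trans (hnormD _ _) _.
  by rewrite hnorm_opp addrC lerD2r.
have edx : e + dx = - ((opinv B \o gram A) \- id) e + (opinv B \o gram A) (e - q)
    + (opinv B \o gram A) v.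
  rewrite (linearmapB lBG) /= Gv Gq -[in LHS](BK dx) Bdx (linearmapD lBi) (linearmapN lBi).
  by rewrite opprB !addrA subrK.
have h1 := le_trans (opnormP (linear_sub lBG lid) (hbounded_sub bBG (@hbounded_id _ _ X)) e)
  (ler_wpM2r (hnorm_ge0 e) Bw2).
have h2 := le_trans (opnormP lBG bBG (e - q)) (ler_wpM2r (hnorm_ge0 (e - q)) Bw1).
have h3 := le_trans (opnormP lBG bBG v) (ler_wpM2r (hnorm_ge0 v) Bw1).
rewrite edx; apply: le_trans (hnormD _ _) _; apply: le_trans (lerD (hnormD _ _) h3) _.
rewrite hnorm_opp; apply: le_trans (lerD (lerD h1 h2) (lexx _)) _.
have h4 : w1 * hnorm (e - q) <= w1 * n by rewrite ler_wpM2l.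
have h5 : w1 * hnorm v <= w1 * (vth * (n + hnorm e)).
  by rewrite ler_wpM2l //; apply: le_trans vq _; rewrite ler_wpM2l.
lra.
Qed.

End Step.

(** * Limits of scalar iterations *)

Section Dynamics.
Context {R : realType}.

(** The sequence is nonincreasing and bounded below; continuity gives [l <= phi l] at its limit [l],
    which is impossible for [0 < l < r]. *)
Lemma iterate_cvg0 (phi : R -> R) (r : R) (a : nat -> R) :
  (forall u : nat -> R, forall l, (forall n, 0 <= u n < r) -> 0 <= l < r ->
     u n @[n --> \oo] --> l -> phi (u n) @[n --> \oo] --> phi l) ->
  (forall t, 0 < t < r -> phi t < t) -> phi 0 = 0 ->
  (forall k, 0 <= a k < r) -> (forall k, a k.+1 <= phi (a k)) ->
  a k @[k --> \oo] --> (0 : R).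
Proof.
move=> phi_cvg phi_lt phi0 ar aS.
have phi_le t : 0 <= t < r -> phi t <= t.
  move=> /andP[]; rewrite le_eqVlt => /orP[/eqP<- _|t0 tr]; first by rewrite phi0.
  by apply/ltW/phi_lt; rewrite t0.
have a_decr : nonincreasing_seq a.
  by apply/nonincreasing_seqP => n; apply: le_trans (aS n) (phi_le _ (ar n)).
have a_ge0 n : 0 <= a n by have /andP[] := ar n.
have a_cvg : cvgn a by apply: nonincreasing_is_cvgn => //; exists 0 => _ [n _ <-].
have l0 : 0 <= limn a by apply: limr_ge => //; exact: nearW.
have lr : 0 <= limn a < r.
  rewrite l0; apply: (@le_lt_trans _ _ (a 0%N)); last by have /andP[] := ar 0%N.
  exact: nonincreasing_cvgn_ge.
have phil := phi_cvg a (limn a) ar lr a_cvg.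
have : limn a <= phi (limn a).
  have aS_cvg : a k.+1 @[k --> \oo] --> limn a by rewrite (cvg_shiftS a).
  by apply: (ler_cvg_to aS_cvg phil); exact: nearW.
move: l0; rewrite le_eqVlt => /orP[/eqP l0 _|l0 l_le]; first by rewrite l0.
by have := phi_lt (limn a); rewrite l0 => /(_ (andP lr).2); rewrite ltNge l_le.
Qed.

Lemma limn_esup_le_near (u : nat -> R) (l : R) :
  (forall e : R, 0 < e -> \forall n \near \oo, u n <= l + e) ->
  (limn_esup (fun n => (u n)%:E) <= l%:E)%E.
Proof.
move=> ul; apply/lee_addgt0Pr => e e0; have [N _ NP] := ul e e0.
apply: (@le_trans _ _ (ereal_sup [set (u n)%:E | n in [set n | (N <= n)%N]])).
  by apply: ereal_inf_lbound; exists [set n | (N <= n)%N] => //; exists N.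
apply: ge_ereal_sup => _ [n Nn <-]; rewrite -EFinD lee_fin; exact: NP.
Qed.

End Dynamics.

(** * The Newton gap of the majorant function *)

Section Majorant.
Context {R : realType}.
Variables (Rad : R) (f f' : R -> R).
Hypotheses (hRad : 0 < Rad) (hf : C1_halfopen Rad f f') (f0 : f 0 = 0) (f'0 : f' 0 = -1).
Hypothesis f'_incr : {in `[0, Rad[ &, {homo f' : u v / u < v}}.

(** For unfolding the radii: [sup] is 0 on a set that is empty or unbounded above, so
    [0 <= t < sup S] already guarantees a genuine supremum. *)
Lemma lt_sup_ge0 (S : set R) t : 0 <= t -> t < sup S -> exists2 u, S u & t < u.
Proof.
move=> t0 tS; have [hS|/sup_out S0] := pselect (has_sup S); last first.
  by move: tS; rewrite S0 ltNge t0.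
have tS0 : 0 < sup S - t by rewrite subr_gt0.
by have [u Su] := sup_adherent tS0 hS; rewrite subKr => tu; exists u.
Qed.

(* Minus the Newton iterate of t for f. *)
Definition newton_gap (t : R) : R := f t / f' t - t.

Lemma newton_gap0 : newton_gap 0 = 0.
Proof. by rewrite /newton_gap f0 mul0r subrr. Qed.

Lemma newton_gapE t : f' t != 0 -> newton_gap t = (t * f' t - f t) / - f' t.
Proof. by move=> h; rewrite /newton_gap; field. Qed.

Lemma newton_gap_gt0 t : 0 < t < Rad -> f' t < 0 -> 0 < newton_gap t.
Proof.
move=> tR t0; rewrite newton_gapE ?lt_eqF //; apply: divr_gt0; last by rewrite oppr_gt0.
rewrite subr_gt0.
by have := convex_gap hf f'_incr tR; rewrite f0 subr0.
Qed.

Lemma newton_gap_cvg (u : nat -> R) l : (forall n, 0 <= u n < Rad) -> 0 <= l < Rad ->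
  f' l != 0 -> u n @[n --> \oo] --> l -> newton_gap (u n) @[n --> \oo] --> newton_gap l.
Proof.
move=> uR lR l0 ul; apply: cvgB => //; apply: cvgM; first exact: (C1_halfopen_cvg hf).
by apply: cvgV => //; exact: (C1_halfopen_deriv_cvg hf).
Qed.

(** Near 0, [f t = - t + o(t)] and [f' t = -1 + o(1)], so the numerator [t f' t - f t] is [o(t)]
    while the denominator [- f' t] stays away from 0. *)
Lemma newton_gap_small (e : R) : 0 < e -> exists2 d : R, 0 < d &
  forall t : R, 0 <= t < Rad -> t < d -> `|newton_gap t| <= e * t.
Proof.
(* The bound 1/2 gives [f' t <= -1/2]; the bound [e / 4] makes the numerator at most
   [2 e' t <= e t / 2]. *)
move=> e0; pose e' := Num.min (e / 4) (1 / 2).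
have e'0 : 0 < e' by rewrite lt_min; apply/andP; split; lra.
have e'e : e' <= e / 4 by rewrite ge_min lexx.
have e'2 : e' <= 1 / 2 by rewrite ge_min lexx orbT.
have R0 : 0 <= (0 : R) < Rad by rewrite lexx.
have [d d0 dP] := C1_halfopen_eps hf R0 e'0.
have /subspace_continuousP /(_ 0 R0) /cvgrPdist_le /(_ e' e'0) := hf.2.
rewrite near_withinE => /nbhs_ballP[d2 /= d20 d2P].
exists (Num.min d d2) => [|t tR]; first by rewrite lt_min d0.
rewrite lt_min => /andP[td td2]; have /andP[t0 _] := tR.
have := dP t tR; rewrite subr0 ger0_norm // => /(_ td); rewrite f0 f'0 subr0 ler_norml.
have := d2P t; rewrite /ball /= sub0r normrN ger0_norm // => /(_ td2 tR).
rewrite /from_subspace f'0 ler_norml => /andP[h1 h2] /andP[h3 h4].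
have ft : f' t <= - (1 / 2) by lra.
rewrite newton_gapE; last by rewrite lt_eqF //; lra.
rewrite normrM normfV normrN (ler0_norm (x := f' t)); last by lra.
rewrite ler_pdivrMr; last by lra.
apply: (@le_trans _ _ (e * t * (1 / 2))); last by rewrite ler_wpM2l ?mulr_ge0 ?(ltW e0) //; lra.
by rewrite ler_norml; apply/andP; split; nra.
Qed.

End Majorant.

(** * The exact Gauss-Newton step under the majorant condition *)

Section LocalAnalysis.
Context {R : realType} {s : scalars} {X Y : hilbert R s}.

Lemma gauss_newton_majorant (Om : set X) (F : X -> Y) (xs : X) (Rad kappa : R)
    (f f' : R -> R) (y : X) :
  C1_on Om F -> (forall y, Om y -> closed (range ('d F y))) -> Om xs ->
  hball xs kappa `<=` Om -> F xs = 0 -> injective ('d F xs) ->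
  C1_halfopen Rad f f' -> f 0 = 0 -> f' 0 = -1 ->
  {in `[0, Rad[ &, {homo f' : u v / u < v}} ->
  (forall tau : R, 0 <= tau <= 1 ->
     opnorm (moore_penrose ('d F xs)) * opnorm ('d F y \- 'd F (xs + of_real s tau *: (y - xs)))
       <= f' (hnorm (y - xs)) - f' (tau * hnorm (y - xs))) ->
  hball xs kappa y -> y <> xs -> hnorm (y - xs) < Rad -> f' (hnorm (y - xs)) < 0 ->
  [/\ linear ('d F y), hbounded ('d F y),
    exists2 c : R, 0 < c & forall v, c * hnorm v <= hnorm ('d F y v)
    & hnorm ((y - xs) - moore_penrose ('d F y) (F y)) <= newton_gap f f' (hnorm (y - xs))].
Proof.
move=> hF Fcl Oxs bO Fxs iF hf f0 f'0 f'_incr hmaj yk yxs yR f'y.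
have Oy := bO y yk.
have lF z : linear ('d F z) by exact: linearP.
have bF z : Om z -> hbounded ('d F z).
  by move=> /hF[dF _]; apply: continuous_hbounded => //; exact: diff_continuous.
have [c c0 cF] := bounded_below (lF xs) (bF _ Oxs) (Fcl _ Oxs) iF.
set b := opnorm _ in hmaj; set e := y - xs in hmaj yR f'y *; set A := 'd F y.
have e0 : 0 < hnorm e by apply: hnorm_gt0 => /subr0_eq.
have mpP := opnormP (moore_penrose_linear (lF xs) (bF _ Oxs) (Fcl _ Oxs) c0 cF)
  (moore_penrose_hbounded (lF xs) (bF _ Oxs) (Fcl _ Oxs) c0 cF).
have bP v : hnorm v <= b * hnorm ('d F xs v).
  by have := mpP ('d F xs v); rewrite (moore_penroseK (lF xs) (bF _ Oxs) (Fcl _ Oxs) c0 cF).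
have b0 : 0 < b.
  rewrite lt_neqAle opnorm_ge0 ?andbT; last first.
    exact: (moore_penrose_hbounded (lF xs) (bF _ Oxs) (Fcl _ Oxs) c0 cF).
  by apply/eqP => b0; have := bP e; rewrite -b0 mul0r leNgt e0.
have inball t : 0 <= t <= 1 -> Om (xs + rscale t e).
  move=> /andP[t0 t1]; apply: bO; rewrite /hball /= addrC addKr hnorm_rscale ger0_norm //.
  by apply: le_lt_trans yk; rewrite ler_piMl // ltW.
have maj t v : 0 <= t <= 1 ->
    b * hnorm (A v - 'd F (xs + rscale t e) v) <= (f' (hnorm e) - f' (t * hnorm e)) * hnorm v.
  move=> t01; have := hmaj t t01; rewrite -/(rscale t e) => h.
  apply: le_trans (ler_wpM2r (hnorm_ge0 v) h); rewrite -mulrA ler_wpM2l ?(ltW b0) //.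
  apply: (opnormP (A := A \- 'd F (xs + rscale t e))).
    exact: (linear_sub (lF y) (lF _)).
  exact: (hbounded_sub (bF _ Oy) (bF _ (inball _ t01))).
(* From [|v| <= b |F'(xs) v|] and the majorant condition at [tau = 0],
   [b |A v| >= |v| - (f'(|e|) + 1) |v|]. *)
pose d := - f' (hnorm e) / b.
have d0 : 0 < d by rewrite divr_gt0 ?oppr_gt0.
have dA v : d * hnorm v <= hnorm (A v).
  rewrite mulrAC ler_pdivrMr //.
  have := maj 0 v; rewrite lexx ler01 rscale0 addr0 mul0r f'0 => /(_ isT) h.
  have h2 := hnormD (A v) ('d F xs v - A v); rewrite addrC subrK in h2.
  rewrite hdistC in h; have := bP v; have := ler_wpM2l (ltW b0) h2.
  by lra.
split; [exact: lF|exact: bF|by exists d|].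
have ye : y = xs + e by rewrite addrC subrK.
have mv : b * hnorm (A e - F y) <= hnorm e * f' (hnorm e) - f (hnorm e).
  rewrite [in F y]ye; apply: (majorant_mean_value (ltW b0) _ hf f0 f'_incr Fxs).
  - by rewrite e0 yR.
  - by move=> t t01; have [] := hF _ (inball _ t01).
  - by move=> t t01; exact: maj.
have bA := bF _ Oy; have cA := Fcl _ Oy.
(* As [moore_penrose A] is a left inverse of [A], the new error is the image of the linearisation
   error, magnified by at most [1 / d]. *)
have -> : e - moore_penrose A (F y) = moore_penrose A (A e - F y).
  rewrite (linearmapB (moore_penrose_linear (lF y) bA cA d0 dA)).
  by rewrite (moore_penroseK (lF y) bA cA d0 dA).
apply: le_trans (moore_penrose_le (lF y) bA cA d0 dA _) _.
rewrite newton_gapE ?lt_eqF // /d invfM invrK ler_pdivlMr ?oppr_gt0 //.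
apply: le_trans mv.
have -> : (- f' (hnorm e))^-1 * b * hnorm (A e - F y) * - f' (hnorm e) = b * hnorm (A e - F y).
  by field; rewrite lt_eqF.
by [].
Qed.

End LocalAnalysis.

(** * Local convergence of the inexact Gauss-Newton like method *)

Theorem theorem2 (R : realType) (s : scalars) (X Y : hilbert R s)
  (Om : set X) (F : X -> Y) (xs : X) (Rad beta kappa : R) (f f' : R -> R)
  (vth w1 w2 nu rho r : R)
  (x dx res : nat -> X) (B P : nat -> X -> X) (theta t : nat -> R)
  (hOm : open Om)
  (hF : C1_on Om F)
  (hFclosed : forall y, Om y -> closed (range ('d F y)))
  (hxs : Om xs)
  (hRad : 0 < Rad)
  (hbeta : beta = opnorm (moore_penrose ('d F xs)))
  (hkappa : kappa = sup [set u : R | 0 <= u < Rad /\ hball xs u `<=` Om])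
  (hFxs : F xs = 0)
  (hinj : injective ('d F xs))
  (hf : C1_halfopen Rad f f')
  (hmaj : forall (tau : R) (y : X), 0 <= tau <= 1 -> hball xs kappa y ->
     beta * opnorm ('d F y \- 'd F (xs + of_real s tau *: (y - xs)))
       <= f' (hnorm (y - xs)) - f' (tau * hnorm (y - xs)))
  (h1 : f 0 = 0 /\ f' 0 = -1)
  (h2 : {in `[0, Rad[ &, {homo f' : u v / u < v}})
  (hvth : 0 <= vth < 1)
  (hw : 0 <= w2 < w1)
  (hw1 : w1 * vth + w2 < 1)
  (hnu : nu = sup [set u : R | 0 <= u < Rad /\ f' u < 0])
  (hrho : rho = sup [set d : R | 0 < d < nu /\
     forall u, 0 < u < d ->
       (1 + vth) * w1 * (f u / f' u - u) / u + w1 * vth + w2 < 1])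
  (hr : r = Num.min kappa rho)
  (hx0 : hball xs r (x 0%N)) (hx0s : x 0%N <> xs)
  (hstep : forall k, gn_defined Om F (x k) ->
     let A := 'd F (x k) in
     [/\ x k.+1 = x k + dx k,
         B k (dx k) = - adjoint A (F (x k)) + res k,
         invertible_op (B k) /\
         opnorm (opinv (B k) \o gram A) <= w1 /\
         opnorm ((opinv (B k) \o gram A) \- id) <= w2,
         invertible_op (P k) /\
         hnorm (P k (res k)) <= theta k * hnorm (P k (adjoint A (F (x k))))
       & 0 <= theta k * cond (P k \o gram A) <= vth])
  (ht0 : t 0%N = hnorm (x 0%N - xs))
  (htS : forall k, t k.+1 =
     (1 + vth) * w1 * `|t k - f (t k) / f' (t k)| + (w1 * vth + w2) * t k) :
  [/\ (forall k, gn_defined Om F (x k)) /\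
      (forall k, 0 <= t k < Rad /\ f' (t k) != 0),
      [/\ forall k, t k.+1 < t k,
          forall k, 0 < t k < r
        & t k @[k --> \oo] --> (0 : R)],
      (forall k, hball xs r (x k)) /\ x k @[k --> \oo] --> xs,
      (limn_esup (fun k => (hnorm (x k.+1 - xs) / hnorm (x k - xs))%:E)
         <= (w1 * vth + w2)%:E)%E /\
      t k.+1 / t k @[k --> \oo] --> w1 * vth + w2
    & forall p : R, 0 <= p <= 1 ->
      {in `]0, nu[ &,
         {homo (fun u => (f u / f' u - u) / u `^ (p + 1)) : u v / u < v}} ->
      (forall k, hnorm (x k.+1 - xs) <=
         (1 + vth) * w1
           * ((f (t 0%N) - t 0%N * f' (t 0%N)) / (t 0%N `^ (p + 1) * f' (t 0%N)))
           * hnorm (x k - xs) `^ (p + 1)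
         + (w1 * vth + w2) * hnorm (x k - xs)) /\
      (forall k, hnorm (x k - xs) <= t k)].
Proof.
have [f0 f'0] := h1.
have /andP[vth0 vth1] := hvth; have /andP[w20 w21] := hw.
have w10 : 0 < w1 by lra.
have C0 : 0 < (1 + vth) * w1 by apply: mulr_gt0 => //; lra.
have D0 : 0 <= w1 * vth + w2 by rewrite addr_ge0 // mulr_ge0 // ltW.
set gap := newton_gap f f'; set C := (1 + vth) * w1 in C0 htS *.
set D := w1 * vth + w2 in hw1 D0 htS *.
(* On [[0, r)] the gap is nonnegative, so [phi] is the recursion of [t] without its absolute value;
   it also bounds one step of the error of [x]. *)
pose phi u := C * gap u + D * u.
have phi0 : phi 0 = 0 by rewrite /phi /gap newton_gap0 // !mulr0 addr0.
have kO : hball xs kappa `<=` Om.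
  move=> y; rewrite /hball /= hkappa => /(lt_sup_ge0 (hnorm_ge0 _))[u [_ uO] yu].
  exact: uO.
have nuP u : 0 <= u < nu -> u < Rad /\ f' u < 0.
  rewrite hnu => /andP[u0 /(lt_sup_ge0 u0)[v [/andP[v0 vR] f'v] uv]].
  have uR := lt_trans uv vR; split=> //; apply: lt_trans f'v.
  by apply: h2; rewrite // in_itv /= ?u0 ?v0.
(* Multiplied by [u], the inequality defining [rho] reads [phi u < u]. *)
have rhoP u : 0 < u < rho -> u < nu /\ phi u < u.
  rewrite hrho => /andP[u0 /(lt_sup_ge0 (ltW u0))[d [/andP[d0 dnu] dP] ud]].
  split; first exact: lt_trans dnu.
  have := dP u; rewrite u0 ud -/C -/(newton_gap f f' u) -/gap -addrA -/D => /(_ isT).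
  rewrite -(ltr_pM2r u0) mulrDl divfK ?mul1r ?gt_eqF //.
have rk u : u < r -> u < kappa by rewrite hr lt_min => /andP[].
have rP u : 0 < u < r -> u < nu /\ phi u < u.
  by move=> /andP[u0 ur]; apply: rhoP; move: ur; rewrite hr lt_min u0 => /andP[].
have t0r : 0 < t 0%N < r.
  by rewrite ht0 hx0 andbT; apply: hnorm_gt0 => /subr0_eq.
have nu0 : 0 < nu by have [tnu _] := rP _ t0r; apply: lt_trans tnu; case/andP: t0r.
have r0P u : 0 <= u < r -> u < Rad /\ f' u < 0.
  move=> /andP[u0 ur]; apply: nuP; rewrite u0 /=.
  move: u0; rewrite le_eqVlt => /orP[/eqP<- //|u0].
  by have [] := rP u; rewrite ?u0.
have rR u : 0 <= u < r -> 0 <= u < Rad.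
  by move=> ur; have [-> _] := r0P u ur; case/andP: ur => ->.
have gap_gt0 u : 0 < u < nu -> 0 < gap u.
  move=> /andP[u0 un]; have [|uR f'u] := nuP u; first by rewrite (ltW u0).
  by apply: (newton_gap_gt0 hf f0 h2); rewrite ?u0.
have phi_cvg (u : nat -> R) l : (forall n, 0 <= u n < r) -> 0 <= l < r ->
    u n @[n --> \oo] --> l -> phi (u n) @[n --> \oo] --> phi l.
  move=> ur lr ul; apply: cvgD; last by apply: cvgMr.
  apply: cvgMr; apply: (newton_gap_cvg hf) => //; [by move=> n; exact: rR|exact: rR|].
  by have [_ /lt_eqF ->] := r0P l lr.
have phi_lt u : 0 < u < r -> phi u < u by move=> /rP[].
have phi_gt0 u : 0 < u < r -> 0 < phi u.
  move=> /[dup] /rP[unu _] /andP[u0 _]; rewrite ltr_wpDr ?mulr_ge0 ?(ltW u0) //.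
  by rewrite mulr_gt0 // gap_gt0 // u0.
have phi_le u : 0 <= u < r -> phi u <= u.
  move=> /andP[]; rewrite le_eqVlt => /orP[/eqP<- _|u0 ur]; first by rewrite phi0.
  by apply/ltW/phi_lt; rewrite u0.
have tS k : 0 < t k < r -> t k.+1 = phi (t k).
  move=> /[dup] /rP[tnu _] /andP[t0 _]; rewrite htS /phi distrC -/(newton_gap f f' _) -/gap.
  by rewrite ger0_norm //; apply/ltW/gap_gt0; rewrite t0.
have tr k : 0 < t k < r.
  elim: k => // k IH; rewrite tS // phi_gt0 //=; apply: lt_trans (phi_lt _ IH) _.
  by case/andP: IH.
have tr0 k : 0 <= t k < r by have /andP[/ltW-> ->] := tr k.
have tS_lt k : t k.+1 < t k by rewrite tS // phi_lt.
have t_cvg : t k @[k --> \oo] --> (0 : R).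
  by apply: (@iterate_cvg0 _ phi r) => // k; rewrite tS.
have local y : hball xs r y -> [/\ Om y, linear ('d F y) /\ hbounded ('d F y),
    exists2 c : R, 0 < c & forall v, c * hnorm v <= hnorm ('d F y v)
    & hnorm ((y - xs) - moore_penrose ('d F y) (F y)) <= gap (hnorm (y - xs))].
  move=> yr; have yk : hball xs kappa y by exact: rk.
  have Oy := kO _ yk.
  have lF : linear ('d F y) by exact: linearP.
  (* The iterates may hit [xs]; there the lower bound comes from injectivity and closed range, and
     both sides of the error estimate are 0. *)
  have [yxs|/eqP yxs] := eqVneq y xs.
    have bF : hbounded ('d F y).
      by have [dF _] := hF _ Oy; apply: continuous_hbounded => //; exact: diff_continuous.
    have iF : injective ('d F y) by rewrite yxs.
    have [c c0 cF] := bounded_below lF bF (hFclosed _ Oy) iF.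
    split=> //; first by exists c.
    have -> : F y = 0 by rewrite yxs.
    rewrite (linearmap0 (moore_penrose_linear lF bF (hFclosed _ Oy) c0 cF)) subr0.
    by rewrite yxs subrr hnorm0 /gap newton_gap0.
  have [|yR f'y] := r0P (hnorm (y - xs)); first by rewrite hnorm_ge0.
  have [|_ bF cF gapF] :=
    gauss_newton_majorant hF hFclosed hxs kO hFxs hinj hf f0 f'0 h2 _ yk yxs yR f'y.
    by move=> tau tau01; rewrite -hbeta; exact: hmaj.
  by [].
have gn y : hball xs r y -> gn_defined Om F y.
  move=> /local[Oy [lF bF] [c c0 cF] _]; split => //.
  exact: (gram_invertible lF bF (hFclosed _ Oy) c0 cF).
have step k : hball xs r (x k) -> hnorm (x k.+1 - xs) <= phi (hnorm (x k - xs)).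
  move=> xr; have [Oy [lF bF] [c c0 cF] gapF] := local _ xr.
  have [-> Bdx [iB [Bw1 Bw2]] [iP Pres] tcond] := hstep k (gn _ xr).
  rewrite addrAC.
  exact: (inexact_step_le lF bF (hFclosed _ Oy) c0 cF iB iP Bdx Bw1 Bw2 Pres tcond gapF).
have xr k : hball xs r (x k).
  elim: k => // k IH; rewrite /hball /=; apply: le_lt_trans (step _ IH) _.
  by apply: (le_lt_trans (phi_le _ _) IH); rewrite hnorm_ge0 /=; exact: IH.
have er k : 0 <= hnorm (x k - xs) < r by rewrite hnorm_ge0 /=; exact: xr.
have e_cvg : hnorm (x k - xs) @[k --> \oo] --> (0 : R).
  by apply: (@iterate_cvg0 _ phi r) => // k; exact: step.
have eS k : hnorm (x k.+1 - xs) <= hnorm (x k - xs).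
  by apply: le_trans (step _ (xr k)) (phi_le _ (er k)).
have e0 k : hnorm (x k - xs) <= t 0%N.
  by elim: k => [|k IH]; [rewrite ht0|exact: le_trans IH].
(* Since [phi u / u = D + C * gap u / u] with [gap u] positive and [o(u)], one estimate serves both
   the limsup and the limit. *)
have ratio (e : R) : 0 < e -> exists2 d : R, 0 < d &
    forall u : R, 0 < u < r -> u < d -> phi u / u <= D + e /\ D <= phi u / u.
  move=> e_gt0.
  have [d d0 dP] := newton_gap_small hRad hf f0 f'0 (divr_gt0 e_gt0 C0).
  exists d => // u /[dup] ur /andP[u0 _] ud.
  have gu : 0 < gap u by apply: gap_gt0; have [-> _] := rP _ ur; rewrite u0.
  have ur' : 0 <= u < r by case/andP: ur => /ltW-> ->.
  have := dP u (rR _ ur') ud.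
  rewrite (gtr0_norm gu) mulrAC ler_pdivlMr // mulrC => h.
  rewrite ler_pdivrMr // ler_pdivlMr // /phi; split; first by lra.
  by rewrite lerDr mulr_ge0 ?ltW.
split.
- split=> k; first exact/gn/xr.
  by rewrite rR //; have [_ /lt_eqF ->] := r0P _ (tr0 k).
- by split.
- by split=> //; apply/hcvgP.
- split.
    apply: limn_esup_le_near => e e_gt0; have [d d0 dP] := ratio e e_gt0.
    move/cvgr0Pnorm_lt: e_cvg => /(_ d d0) e_cvg; near=> n.
    (* At [x n = xs] the quotient is 0 by the convention [0^-1 = 0]. *)
    have [en|/eqP en] := eqVneq (hnorm (x n - xs)) 0.
      by rewrite en invr0 mulr0 addr_ge0 // ltW.
    have en0 : 0 < hnorm (x n - xs) by rewrite lt_neqAle hnorm_ge0 andbT eq_sym; apply/eqP.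
    apply: le_trans (dP (hnorm (x n - xs)) _ _).1.
    + by rewrite ler_pM2r ?invr_gt0 // step.
    + by rewrite en0; exact: xr.
    + by rewrite -[ltLHS]ger0_norm ?hnorm_ge0 //; near: n.
  apply/cvgrPdist_le => e e_gt0; have [d d0 dP] := ratio e e_gt0.
  move/cvgr0Pnorm_lt: t_cvg => /(_ d d0) t_cvg; near=> n.
  rewrite tS //; have [] := dP (t n) (tr n).
    have tn0 : 0 <= t n by case/andP: (tr0 n).
    by rewrite -[ltLHS]ger0_norm //; near: n.
  by move=> h3 h4; rewrite ler0_norm; lra.
move=> p /andP[p0 p1] h3.
(* [G] is the function of (h3). Being monotone, it bounds [gap u] by [G (t 0) * u^(p+1)] for
   [u <= t 0], and makes [gap] itself monotone. *)
pose G u := gap u / u `^ (p + 1).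
have pow_gt0 u : 0 < u -> 0 < u `^ (p + 1) by exact: powR_gt0.
have gapG u : 0 < u -> gap u = G u * u `^ (p + 1).
  by move=> /pow_gt0 u0; rewrite /G divfK // gt_eqF.
have Gle u v : 0 < u -> u <= v -> v < nu -> G u <= G v.
  move=> u0; rewrite le_eqVlt => /orP[/eqP-> //|uv vnu]; apply/ltW/h3 => //.
    by rewrite in_itv /= u0 (lt_trans uv).
  by rewrite in_itv /= vnu (lt_trans u0).
have [t0nu _] := rP _ t0r.
(* Needed when the error is 0: the power of 0 vanishes only for a nonzero exponent. *)
have p10 : p + 1 != 0 by rewrite gt_eqF //; lra.
split=> k.
  have -> : (f (t 0%N) - t 0%N * f' (t 0%N)) / (t 0%N `^ (p + 1) * f' (t 0%N)) = G (t 0%N).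
    have [_ f't0] := r0P _ (tr0 0%N).
    rewrite /G /gap /newton_gap; field.
    by rewrite (lt_eqF f't0) /= gt_eqF // pow_gt0 //; case/andP: t0r.
  apply: le_trans (step _ (xr k)) _; rewrite /phi lerD2r.
  have := hnorm_ge0 (x k - xs); rewrite le_eqVlt => /orP[/eqP<-|ek].
    by rewrite /gap newton_gap0 // powR0 // !mulr0.
  by rewrite gapG // -mulrA ler_pM2l // ler_pM2r ?pow_gt0 // Gle.
(* Induction by monotonicity: both factors of [gap u = G u * u^(p+1)] increase from the error of
   [x k] to [t k]. *)
elim: k => [|k IH]; first by rewrite ht0.
apply: le_trans (step _ (xr k)) _; rewrite tS //.
have := hnorm_ge0 (x k - xs); rewrite le_eqVlt => /orP[/eqP<-|ek].
  by rewrite phi0 ltW // phi_gt0.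
have [tnu _] := rP _ (tr k).
apply: lerD; last by rewrite ler_wpM2l.
rewrite ler_pM2l // gapG // [leRHS]gapG; last by case/andP: (tr k).
apply: ler_pM; [|exact/ltW/pow_gt0|exact: Gle|].
  by rewrite /G divr_ge0 ?ltW ?pow_gt0 // gap_gt0 // ek (le_lt_trans IH).
by apply: ge0_ler_powR; rewrite ?nnegrE ?hnorm_ge0 ?(le_trans (hnorm_ge0 _) IH) //; lra.
Unshelve. all: by end_near. Qed.
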